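(* Let $h\in\operatorname{End}(\mathbb{C}^N)$, $z_1,\dots,z_n\in\mathbb{C}$, let $\lambda$ be a partition, and let $m\ge\max\{n,|\lambda|\}$ be an integer. Then $$T_\lambda(u)=\sum_{\substack{K\subseteq[n],\ L\subseteq[m],\\ K\subseteq L,\ |L|=|\lambda|}}\frac{(m-|\lambda|)!}{(m-|K|)!}\,\Big(\prod_{l\in[n]\setminus K}(u+z_l)\Big)\,\operatorname{Tr}_{L\setminus K}\big(h^{(L\setminus K)}\alpha_\lambda^{(L)}\big)$$ as elements of $\operatorname{End}((\mathbb{C}^N)^{\otimes n})$ (polynomial in $u$).
   Context: $[n]=\{1,\dots,n\}$; $E_{i,j}\in\operatorname{End}(\mathbb{C}^N)$ denotes the matrix unit, and $A^{(k)}$ denotes $A$ acting in the tensor factor indexed by $k$. For a finite set $L$, $(\mathbb{C}^N)^{\otimes L}$ is the tensor product of copies of $\mathbb{C}^N$ indexed by $L$; for $K\subseteq L$, $\operatorname{End}((\mathbb{C}^N)^{\otimes K})$ is viewed as the subalgebra of $\operatorname{End}((\mathbb{C}^N)^{\otimes L})$ acting as the identity on factors in $L\setminus K$. $h^{(K)}=\prod_{k\in K}h^{(k)}$ is the diagonal action $h^{\otimes K}$ on the factors in $K$ (the identity if $K=\varnothing$). Partial trace: $\operatorname{Tr}_{L\setminus K}:\operatorname{End}((\mathbb{C}^N)^{\otimes L})\to\operatorname{End}((\mathbb{C}^N)^{\otimes K})$ is the linear map with $\operatorname{Tr}_{L\setminus K}\big(\bigotimes_{l\in L}A_l\big)=\prod_{l\in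 L\setminus K}\operatorname{Tr}(A_l)\cdot\bigotimes_{k\in K}A_k$. In the formula, $h^{(L\setminus K)}\alpha_\lambda^{(L)}$ acts on $(\mathbb{C}^N)^{\otimes L}$, and its partial trace, in $\operatorname{End}((\mathbb{C}^N)^{\otimes K})$, is viewed in $\operatorname{End}((\mathbb{C}^N)^{\otimes n})$. For $|L|=|\lambda|$, $\alpha_\lambda^{(L)}=\sum_{\sigma\in\mathfrak{S}_L}\chi^\lambda(\sigma)\sigma\in\mathbb{C}[\mathfrak{S}_L]$, where $\chi^\lambda$ is the irreducible character of the symmetric group $\mathfrak{S}_L$ indexed by $\lambda$ ($\chi^{(m)}$ trivial, $\chi^{(1^m)}$ sign), and $\mathfrak{S}_L$ acts by $\sigma(\bigotimes_{l\in L}v_l)=\bigotimes_{l\in L}v_{\sigma^{-1}(l)}$. Higher Gaudin Hamiltonians: $s_\lambda(h)$ is the Schur polynomial $s_\lambda(x_1,\dots,x_N)$ evaluated at the eigenvalues of $h$ ($0$ if $\lambda$ has more than $N$ nonzero parts). For a polynomial function $f$ on $\operatorname{End}(\mathbb{C}^N)$ and $K\subseteq[n]$, $$\mathsf{d}_Kf(h)=\sum_{(i_k,j_k)_{k\in K}\in([N]^2)^K}\Big(\prod_{k\in K}\partial_{\varepsilon_k}\Big)\Big|_{\varepsilon=0}f\Big(h+\sum_{k\in K}\varepsilon_kE_{j_k,i_k}\Big)\cdot\prod_{k\in K}E_{i_k,j_k}^{(k)},$$ with $\mathsf{d}_\varnothing f(h)=f(h)\cdot\mathrm{Id}$, and $$T_\lambda(u)=(u+z_1+\mathsf{d}_1)\cdots(u+z_n+\mathsf{d}_n)s_\lambda(h)=\sum_{K\subseteq[n]}\Big(\prod_{k\in[n]\setminus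 K}(u+z_k)\Big)\mathsf{d}_Ks_\lambda(h).$$ *)

(* Defs.v *)
From HB Require Import structures.
From mathcomp Require Import all_boot all_order all_algebra all_fingroup.
From mathcomp Require Import mxrepresentation.
From mathcomp Require Import finmap.
From mathcomp Require Import all_classical all_reals all_analysis.
From mathcomp Require Import complex.

Set Implicit Arguments.
Unset Strict Implicit.
Unset Printing Implicit Defensive.

Import Order.TTheory GRing.Theory Num.Theory.
Import numFieldNormedType.Exports.
Local Open Scope ring_scope.

(** * Operators on tensor powers *)

(* End((C^N)^{⊗I}) as matrices, acting on column vectors, in the basis
   e_a = ⊗_l e_(a l) indexed by the multi-indices a : {ffun I -> 'I_N}; rows
   and columns are numbered by the enumeration of these multi-indices. *)
Notation tend C N I := 'M[C]_#|{ffun I -> 'I_N}|.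

Definition mkop (C : pzRingType) (N : nat) (I : finType)
    (F : {ffun I -> 'I_N} -> {ffun I -> 'I_N} -> C) : tend C N I :=
  \matrix_(i, j) F (enum_val i) (enum_val j).

Definition coefop (C : pzRingType) (N : nat) (I : finType)
    (A : tend C N I) (a b : {ffun I -> 'I_N}) : C :=
  A (enum_rank a) (enum_rank b).

(* ⊗_l A_l *)
Definition tensor_op (C : comPzRingType) (N : nat) (I : finType)
    (A : I -> 'M[C]_N) : tend C N I :=
  mkop (fun a b => \prod_l A l (a l) (b l)).

(* σ (⊗_l v_l) = ⊗_l v_(σ^-1 l), i.e. σ e_b = e_a where a (σ l) = b l *)
Definition perm_op (C : pzRingType) (N : nat) (I : finType) (s : {perm I}) :
    tend C N I :=
  mkop (fun a b => [forall l, a (s l) == b l]%:R).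

(** The tensor factors are labelled by natural numbers. *)

(* [n] = {1, ..., n} *)
Definition seg (n : nat) : {fset nat} := [fset k in iota 1 n]%fset.

(* A^(k) *)
Definition at_factor (C : comPzRingType) (N : nat) (L : {fset nat})
    (k : nat) (A : 'M[C]_N) : tend C N L :=
  tensor_op (fun l : L => if val l == k then A else 1%:M).

(* h^(K) *)
Definition diag_action (C : comPzRingType) (N : nat) (L K : {fset nat})
    (h : 'M[C]_N) : tend C N L :=
  \prod_(k <- K) at_factor L k h.

(* the multi-index b on L restricts to the multi-index a on K *)
Definition restricts (N : nat) (K L : {fset nat})
    (a : {ffun K -> 'I_N}) (b : {ffun L -> 'I_N}) : bool :=
  [forall k : K, forall l : L, (val k == val l) ==> (a k == b l)].

Definition agree_off (N : nat) (K L : {fset nat})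
    (b b' : {ffun L -> 'I_N}) : bool :=
  [forall l : L, (val l \notin K) ==> (b l == b' l)].

(* Tr_(L \ K) : End((C^N)^{⊗L}) -> End((C^N)^{⊗K}), for K ⊆ L: sum of the
   diagonal entries in the factors of L \ K; see [ptraceP]. *)
Definition ptrace (C : pzRingType) (N : nat) (L K : {fset nat})
    (A : tend C N L) : tend C N K :=
  mkop (fun a a' =>
    \sum_(b | restricts a b)
      \sum_(b' | restricts a' b' && agree_off K b b') coefop A b b').

(* End((C^N)^{⊗K}) ⊆ End((C^N)^{⊗L}), for K ⊆ L; see [extend_opP]. *)
Definition extend_op (C : pzRingType) (N : nat) (K L : {fset nat})
    (A : tend C N K) : tend C N L :=
  mkop (fun b b' => \sum_(a | restricts a b) \sum_(a' | restricts a' b')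
    (agree_off K b b')%:R * coefop A a a').

(** * Young diagrams *)

Definition is_partition (lam : seq nat) : bool :=
  sorted geq lam && (0%N \notin lam).

(* The cells of the diagram of lam are numbered 0, ..., |lam| - 1 row by row
   (English convention); the cell numbered p lies in row [reshape_index lam p]
   and column [reshape_offset lam p]. *)

(** Schur polynomials, as generating functions of semistandard tableaux *)
Definition semistandard (lam : seq nat) (N : nat)
    (T : {ffun 'I_(sumn lam) -> 'I_N}) : bool :=
  [forall p : 'I_(sumn lam), forall q : 'I_(sumn lam),
     ((reshape_index lam p == reshape_index lam q) &&
      (reshape_offset lam p <= reshape_offset lam q)%N ==> (T p <= T q)%N) &&
     ((reshape_offset lam p == reshape_offset lam q) &&
      (reshape_index lam p < reshape_index lam q)%N ==> (T p < T q)%N)].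

Definition schur (C : comPzRingType) (lam : seq nat) (N : nat)
    (x : 'I_N -> C) : C :=
  \sum_(T : {ffun 'I_(sumn lam) -> 'I_N} | semistandard T) \prod_p x (T p).

(* the eigenvalues of h, with their algebraic multiplicities *)
Definition eigvals (C : closedFieldType) (N : nat) (h : 'M[C]_N) : seq C :=
  sval (closed_field_poly_normal (char_poly h)).

Definition schur_mx (C : closedFieldType) (lam : seq nat) (N : nat)
    (h : 'M[C]_N) : C :=
  schur lam (fun i : 'I_N => (eigvals h)`_i).

(** Irreducible characters of the symmetric group of a finite set I *)

(* For #|I| = |lam|, I is bijected with the cells of lam via its enumeration:
   this is the tableau whose row and column stabilisers are used. *)
Definition row_stab (lam : seq nat) (I : finType) : {set {perm I}} :=
  [set s : {perm I} | [forall x,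
     reshape_index lam (enum_rank (s x)) == reshape_index lam (enum_rank x)]].

Definition col_stab (lam : seq nat) (I : finType) : {set {perm I}} :=
  [set s : {perm I} | [forall x,
     reshape_offset lam (enum_rank (s x)) == reshape_offset lam (enum_rank x)]].

(* The Young symmetrizer, in the regular representation of S_I (whose basis
   is indexed through [gring_index]). *)
Definition young_symmetrizer (F : fieldType) (lam : seq nat) (I : finType) :
    'rV[F]_#|[set: {perm I}]%G| :=
  \sum_(p in row_stab lam I) \sum_(q in col_stab lam I)
    (-1) ^+ odd_perm q *:
      delta_mx 0 (gring_index [set: {perm I}]%G (p * q)%g).

(* The Specht module: the right ideal generated by the Young symmetrizer. *)
Definition specht_repr (F : fieldType) (lam : seq nat) (I : finType) :=
  submod_repr (cyclic_mx_module (regular_repr F [set: {perm I}]%G)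
                                (young_symmetrizer F lam I)).

(* chi^lam *)
Definition specht_char (F : fieldType) (lam : seq nat) (I : finType)
    (s : {perm I}) : F :=
  \tr (specht_repr F lam I s).

(* alpha_lam^(I), acting on (F^N)^{⊗I} *)
Definition alpha_op (F : fieldType) (N : nat) (lam : seq nat) (I : finType) :
    tend F N I :=
  \sum_(s : {perm I}) specht_char F lam s *: perm_op F N s.

(** * Higher Gaudin Hamiltonians *)

(* the partial derivative ∂_k, and the iterated one ∏_k ∂_k *)
Definition pderiv (C : numClosedFieldType) (J : finType) (k : J)
    (F : (J -> C) -> C) (e : J -> C) : C :=
  derive1 (fun t : C => F [eta e with k |-> t]) (e k).

Definition mixed_pderiv (C : numClosedFieldType) (J : finType)
    (F : (J -> C) -> C) : (J -> C) -> C :=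
  foldr (@pderiv C J) F (enum J).

(* d_K f(h), in End((C^N)^{⊗L}) with K ⊆ L; the pair p k is (i_k, j_k) *)
Definition dop (C : numClosedFieldType) (N : nat) (L K : {fset nat})
    (f : 'M[C]_N -> C) (h : 'M[C]_N) : tend C N L :=
  \sum_(p : {ffun K -> 'I_N * 'I_N})
    mixed_pderiv
      (fun e : K -> C => f (h + \sum_k e k *: delta_mx (p k).2 (p k).1))
      (fun=> 0)
    *: \prod_k at_factor L (val k) (delta_mx (p k).1 (p k).2).

(* ∏_(k in [n] \ K) (u + z_k), where u is the polynomial variable *)
Definition shift_prod (C : comNzRingType) (n : nat) (z : nat -> C)
    (K : {fset nat}) : {poly C} :=
  \prod_(k <- (seg n `\` K)%fset) ('X + (z k)%:P).

(* T_lam(u) as an operator with coefficients in C[u] *)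
Definition gaudin (C : numClosedFieldType) (N n : nat) (lam : seq nat)
    (h : 'M[C]_N) (z : nat -> C) : tend {poly C} N (seg n) :=
  \sum_(K <- fpowerset (seg n))
    shift_prod n z K *: map_mx polyC (dop (seg n) K (schur_mx lam (N := N)) h).

(** * Characterisations of the partial trace and of the inclusion *)
Lemma bigprod_fsetsub (C : comPzRingType) (K L : {fset nat}) (F : nat -> C) :
  (K `<=` L)%fset ->
  \prod_(l : L) F (val l) =
    \prod_(k : K) F (val k) * \prod_(l <- (L `\` K)%fset) F l.
Proof.
move=> KL; rewrite -!(big_seq_fsetE _ _ xpredT) /= (big_fsetID _ (mem K)) /=.
congr (_ * _); apply: eq_fbigl => x; rewrite !inE /=; last by rewrite andbC.
by rewrite andbC; case: (boolP (x \in K)) => //= xK; rewrite (fsubsetP KL).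
Qed.

Lemma ptraceP (C : comPzRingType) (N : nat) (L K : {fset nat})
    (A : nat -> 'M[C]_N) : (K `<=` L)%fset ->
  ptrace K (tensor_op (fun l : L => A (val l))) =
  (\prod_(l <- (L `\` K)%fset) \tr (A l)) *:
    tensor_op (fun k : K => A (val k)).
Proof.
move=> KL; apply/matrixP => i j; rewrite !mxE.
set a := enum_val i; set a' := enum_val j.
pose cnd (l : L) x y := [forall k : K, (val k == val l) ==> (a k == x)]
   && ([forall k : K, (val k == val l) ==> (a' k == y)]
   && ((val l \notin K) ==> (x == y))).
pose G (l : L) := \sum_x \sum_y (if cnd l x y then A (val l) x y else 0).
transitivity (\prod_l G l).
  rewrite bigA_distr_bigA /= big_mkcond; apply: eq_bigr => b _.
  rewrite bigA_distr_bigA /=.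
  case: ifP => [/forallP rb|/negbT]; last first.
    rewrite negb_forall => /existsP[k]; rewrite negb_forall => /existsP[l].
    rewrite negb_imply => /andP[kl ab]; rewrite big1 // => b' _.
    rewrite (bigD1 l) //= /cnd (_ : [forall k0, _] = false) ?mul0r //.
    apply/negbTE; rewrite negb_forall; apply/existsP; exists k.
    by rewrite negb_imply kl.
  rewrite big_mkcond; apply: eq_bigr => b' _.
  case: ifP => [/andP[/forallP rb' /forallP ag]|/negbT].
    rewrite /coefop mxE !enum_rankK; apply: eq_bigr => l _.
    rewrite /cnd ag andbT.
    have -> : [forall k : K, (val k == val l) ==> (a k == b l)].
      by apply/forallP => k; exact: (forallP (rb k)).
    have -> // : [forall k : K, (val k == val l) ==> (a' k == b' l)].
    by apply/forallP => k; exact: (forallP (rb' k)).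
  rewrite negb_and => /orP[|].
    rewrite negb_forall => /existsP[k]; rewrite negb_forall => /existsP[l].
    rewrite negb_imply => /andP[kl ab]; rewrite (bigD1 l) //= /cnd.
    rewrite (_ : [forall k0, _ ==> (a' k0 == _)] = false) ?andbF ?mul0r //.
    apply/negbTE; rewrite negb_forall; apply/existsP; exists k.
    by rewrite negb_imply kl.
  rewrite negb_forall => /existsP[l ag]; rewrite (bigD1 l) //= /cnd.
  by rewrite (negbTE ag) !andbF mul0r.
pose H (l : nat) := if insub l : option K is Some k then A l (a k) (a' k)
                    else \tr (A l).
rewrite (eq_bigr (fun l : L => H (val l))); last first.
  move=> l _; rewrite /G /H; case: insubP => [k _ kl|lK].
    have uk (k' : K) : (val k' == val l) = (k' == k).
      by rewrite -kl -val_eqE.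
    have c (d : {ffun K -> 'I_N}) x :
        [forall k0 : K, (val k0 == val l) ==> (d k0 == x)] = (d k == x).
      apply/forallP/idP => [/(_ k)|/eqP dk k']; first by rewrite uk eqxx.
      by rewrite uk; apply/implyP => /eqP->; rewrite dk.
    have lK : val l \in K by rewrite -kl; exact: valP.
    rewrite (bigD1 (a k)) //= [X in _ + X]big1 ?addr0; last first.
      move=> x xa; rewrite big1 // => y _; rewrite /cnd c eq_sym.
      by rewrite (negbTE xa).
    rewrite (bigD1 (a' k)) //= [X in _ + X]big1 ?addr0; last first.
      move=> x xa; rewrite /cnd c (c a') [a' k == _]eq_sym (negbTE xa) andbF.
      by [].
    by rewrite /cnd !c !eqxx lK.
  have c (d : {ffun K -> 'I_N}) x :
      [forall k0 : K, (val k0 == val l) ==> (d k0 == x)].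
    by apply/forallP => k; apply/implyP => /eqP kl; rewrite -kl (valP k) in lK.
  apply: eq_bigr => x _; rewrite (bigD1 x) //= [X in _ + X]big1 ?addr0.
    by rewrite /cnd !c lK eqxx.
  by move=> y yx; rewrite /cnd !c lK /= eq_sym (negbTE yx).
rewrite (bigprod_fsetsub _ KL) mulrC; congr (_ * _).
  rewrite !big_seq; apply: eq_bigr => l; rewrite inE => /andP[lK _].
  by rewrite /H insubF // (negbTE lK).
by apply: eq_bigr => k _; rewrite /H valK.
Qed.

Lemma extend_opP (C : comPzRingType) (N : nat) (K L : {fset nat})
    (A : nat -> 'M[C]_N) : (K `<=` L)%fset ->
  extend_op L (tensor_op (fun k : K => A (val k))) =
  tensor_op (fun l : L => if val l \in K then A (val l) else 1%:M).
Proof.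
move=> KL; apply/matrixP => i j; rewrite !mxE.
set b := enum_val i; set b' := enum_val j.
pose r (d : {ffun L -> 'I_N}) : {ffun K -> 'I_N} :=
  [ffun k => d (fincl KL k)].
have rP d a : restricts a d = (a == r d).
  apply/idP/eqP => [/forallP rd|->].
    apply/ffunP => k; rewrite ffunE; apply/eqP.
    by have /forallP/(_ (fincl KL k)) := rd k; rewrite eqxx.
  apply/forallP => k; apply/forallP => l; apply/implyP => /eqP kl.
  by rewrite ffunE; apply/eqP; congr (d _); apply: val_inj.
rewrite (eq_bigl (pred1 (r b))) => [|a]; last exact: rP.
rewrite big_pred1_eq (eq_bigl (pred1 (r b'))) => [|a]; last exact: rP.
rewrite big_pred1_eq /coefop mxE !enum_rankK.
transitivity (\prod_(l : L)
   ((if val l \in K then 1 else (b l == b' l)%:R) *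
    (if val l \in K then A (val l) (b l) (b' l) else 1))); last first.
  by apply: eq_bigr => l _; case: ifP; rewrite ?mul1r // mulr1 mxE.
rewrite big_split /=; congr (_ * _).
  case: (boolP (agree_off K b b')) => [/forallP ag|].
    by rewrite big1 // => l _; case: ifPn => // lK; rewrite (implyP (ag l)).
  rewrite negb_forall => /existsP[l]; rewrite negb_imply => /andP[lK ne].
  by rewrite (bigD1 l) //= (negbTE lK) (negbTE ne) mul0r.
pose H (l : nat) := if l \in K then if insub l : option L is Some l' then
   A l (b l') (b' l') else 1 else 1.
rewrite [RHS](eq_bigr (fun l : L => H (val l))); last first.
  by move=> l _; rewrite /H valK.
rewrite (bigprod_fsetsub _ KL) [X in _ * X]big1_seq ?mulr1; last first.
  by move=> l; rewrite inE /H => /andP[_ /andP[/negbTE->]].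
apply: eq_bigr => k _; rewrite /H (valP k) !ffunE.
by rewrite (_ : val k = val (fincl KL k)) // valK.
Qed.

(* Main.v *)
Require Import Defs.
From HB Require Import structures.
From mathcomp Require Import all_boot all_order all_algebra all_fingroup.
From mathcomp Require Import mxrepresentation pgroup spectral mxred.
From mathcomp Require Import finmap.
From mathcomp Require Import all_classical all_reals all_analysis.
From mathcomp Require Import complex.
From mathcomp Require Import zify ring.

Set Implicit Arguments.
Unset Strict Implicit.
Unset Printing Implicit Defensive.

Import Order.TTheory GRing.Theory Num.Theory.
Local Open Scope ring_scope.

(* For |I| = |lam|, the Frobenius formula |lam|! s_lam(h) =
   sum_s chi^lam(s) Tr(h^(⊗I) s) holds: by Maschke the Specht module is f A for
   an idempotent f, so the right-hand side is |lam|! times the trace of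
   h^(⊗I) f, and f has the same image on words as the Young symmetrizer; that
   image has a basis of weight vectors indexed by semistandard tableaux
   (triangularity for independence, Garnir relations for spanning).

   Polarizing the formula in the directions E_(j_k,i_k), a mixed derivative at 0
   is a sum over the injections K -> L saying which tensor factors are
   differentiated. As chi^lam is a class function, all these injections
   contribute the same amount, namely that of the inclusion K ⊆ L, which is an
   entry of the partial trace. Hence each L contributes (|lam| - |K|)! d_K s_lam(h),
   and there are C(m - |K|, |lam| - |K|) sets L. *)

(** * The action of permutations on words *)

Section Words.
Variables (I : finType) (N : nat).
Implicit Types (a b T : {ffun I -> 'I_N}) (s t p q : {perm I}) (w c : I -> nat).

(* This is a left action, because s * t applies s first. *)
Definition wact a s : {ffun I -> 'I_N} := [ffun x => a (s x)].

Lemma wactM a s t : wact a (s * t)%g = wact (wact a t) s.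
Proof. by apply/ffunP => x; rewrite !ffunE permM. Qed.

Lemma wact1 a : wact a 1%g = a.
Proof. by apply/ffunP => x; rewrite !ffunE perm1. Qed.

Lemma wactK s : cancel (wact^~ s) (wact^~ s^-1%g).
Proof. by move=> a; rewrite -wactM mulVg wact1. Qed.

Lemma wactVK s : cancel (wact^~ s^-1%g) (wact^~ s).
Proof. by move=> a; rewrite -wactM mulgV wact1. Qed.

(** With [w] a row or column index, this measures how far large entries sit in late rows or columns;
    it orders words both for straightening and for triangularity. *)
Definition weight w a : nat := (\sum_x w x * a x)%N.

Definition fstab w : {set {perm I}} := [set s : {perm I} | [forall x, w (s x) == w x]].

Lemma fstabP w s : reflect (forall x, w (s x) = w x) (s \in fstab w).
Proof. by rewrite inE; apply: (iffP forallP) => H x; apply/eqP/H. Qed.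

Lemma group_set_fstab w : group_set (fstab w).
Proof.
apply/group_setP; split=> [|s t /fstabP hs /fstabP ht]; apply/fstabP => x.
  by rewrite perm1.
by rewrite permM ht hs.
Qed.
Canonical fstab_group w := Group (group_set_fstab w).

Lemma tperm_fstab w x y : w x = w y -> tperm x y \in fstab w.
Proof. by move=> wxy; apply/fstabP => z; case: tpermP => [->|->|]. Qed.

Lemma weight_fstab w a s : s \in fstab w -> weight w (wact a s) = weight w a.
Proof.
move=> /fstabP ws; rewrite /weight [RHS](reindex_inj (@perm_inj _ s)) /=.
by apply: eq_bigr => x _; rewrite ffunE ws.
Qed.

(* Since w and w o s^-1 have the same sum, the values of a may be shifted by
   theta + 1/2; then every term of the difference is nonnegative. *)
Lemma weight_lt w a s (theta : nat) :
  (forall y, w y != w (s^-1 y)%g ->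
     (w y < w (s^-1 y)%g)%N = (theta < a y)%N) ->
  (exists y, w y != w (s^-1 y)%g) ->
  (weight w a < weight w (wact a s))%N.
Proof.
move=> mono [y0 ne0].
have E : weight w (wact a s) = (\sum_y w (s^-1 y)%g * a y)%N.
  rewrite [RHS](reindex_inj (@perm_inj _ s)) /=.
  by apply: eq_bigr => x _; rewrite ffunE permK.
have S : (\sum_y (w (s^-1 y)%g) = \sum_y w y)%N.
  rewrite (reindex_inj (@perm_inj _ s)) /=.
  by apply: eq_bigr => x _; rewrite permK.
have sumZ (f : I -> nat) : \sum_y (f y)%:Z = (\sum_y f y)%N.
  by rewrite (big_morph Posz PoszD (erefl _)).
pose d y : int := (w (s^-1 y)%g)%:Z - (w y)%:Z.
have dz : \sum_y d y = 0.
  by rewrite sumrB !sumZ S subrr.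
suff : 0 < \sum_y d y * ((a y)%:Z *+ 2 - (theta%:Z *+ 2 + 1)).
  rewrite (eq_bigr (fun y => 2 * ((w (s^-1 y)%g * a y)%N%:Z - (w y * a y)%N%:Z)
     - d y * (theta%:Z *+ 2 + 1))); last by move=> y _; rewrite /d; lia.
  rewrite sumrB -mulr_suml dz mul0r subr0 -mulr_sumr sumrB !sumZ.
  by rewrite E /weight; lia.
have ge0 y : 0 <= d y * ((a y)%:Z *+ 2 - (theta%:Z *+ 2 + 1)).
  rewrite /d; have [->|ne] := eqVneq (w y) (w (s^-1 y)%g); first by rewrite subrr mul0r.
  have := mono y ne; case: ltnP => h1 h2.
    by apply: mulr_ge0; lia.
  by apply: mulr_le0; lia.
rewrite lt_neqAle sumr_ge0 // andbT eq_sym psumr_neq0 //.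
apply/hasP; exists y0; first by rewrite mem_index_enum.
rewrite /= lt_neqAle ge0 andbT eq_sym /d mulf_eq0 negb_or.
by apply/andP; split; lia.
Qed.

Lemma weight_swap w a x y : (w x < w y)%N -> (a y < a x)%N ->
  (weight w a < weight w (wact a (tperm x y)))%N.
Proof.
move=> wxy ayx; apply: (@weight_lt _ _ _ (a y)); last first.
  by exists x; rewrite tpermV tpermL; lia.
move=> z; rewrite tpermV; case: tpermP => [->|->|]; lia.
Qed.

(** With [c] the row and [w] the column index this is the row condition on semistandard tableaux;
    cells agreeing in both [c] and [w] must carry equal entries. *)
Definition nondec_along c w a :=
  forall x y, c x = c y -> (w x <= w y)%N -> (a x <= a y)%N.

(** A sorted rearrangement is unique, by counting: if [a' x] exceeds [b x], the cells in the fibre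
    of [x] with [a'] at most [b x] form a proper subset of those weakly before [x], all of which
    have [b] at most [b x]; yet rearranging preserves the number of such cells. *)
Lemma nondec_unique c w a s : s \in fstab c ->
  nondec_along c w a -> nondec_along c w (wact a s) -> wact a s = a.
Proof.
move=> /fstabP cs.
have key a' b (u : {perm I}) : (forall x, c (u x) = c x) -> a' = wact b u ->
    nondec_along c w a' -> nondec_along c w b -> forall x, (a' x <= b x)%N.
  move=> cu E na nb x; rewrite leqNgt; apply/negP => lt.
  pose D f := [set y | (c y == c x) && (f y <= b x)%N].
  have sub1 : [set y | (c y == c x) && (w y <= w x)%N] \subset D (fun y => nat_of_ord (b y)).
    apply/fintype.subsetP => y; rewrite !inE => /andP[/eqP cy wy]; rewrite cy eqxx /=.
    exact: nb.
  have sub2 : D (fun y => nat_of_ord (a' y)) \proper [set y | (c y == c x) && (w y <= w x)%N].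
    apply/properP; split.
      apply/fintype.subsetP => y; rewrite !inE => /andP[/eqP cy ay]; rewrite cy eqxx /=.
      rewrite leqNgt; apply/negP => wlt.
      by have := na x y (esym cy) (ltnW wlt); lia.
    by exists x; rewrite !inE eqxx //= -ltnNge.
  have := leq_trans (proper_card sub2) (subset_leq_card sub1).
  suff -> : #|D (fun y => nat_of_ord (b y))| = #|D (fun y => nat_of_ord (a' y))|
    by rewrite ltnn.
  rewrite -[RHS](card_imset _ (@perm_inj _ u)); apply: eq_card => y.
  rewrite -[y](permKV u) mem_imset; last exact: perm_inj.
  by rewrite !inE cu E ffunE.
move=> na nb; apply/ffunP => x; apply/val_inj/anti_leq/andP.
split; first exact: (key _ a s).
apply: (key _ (wact a s) s^-1%g) => //; last by rewrite wactK.
by move=> y; rewrite -[in RHS](permKV s y) cs.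
Qed.

(** A descent could be swapped inside the fibre of [c], raising the weight above its maximum. *)
Lemma weight_max_nondec c w a s : s \in fstab c ->
  (forall t, t \in fstab c -> (weight w (wact a t) <= weight w (wact a s))%N) ->
  forall x y, c x = c y -> (w x < w y)%N -> (wact a s x <= wact a s y)%N.
Proof.
move=> sc smax x y cxy wxy; rewrite leqNgt; apply/negP => lt.
have := weight_swap wxy lt; rewrite ltnNge => /negP; apply.
by rewrite -wactM smax // groupM // tperm_fstab.
Qed.

End Words.

(** * Specht modules inside the space of words *)

Section WordModule.
Variables (F : fieldType) (I : finType) (N : nat).
Local Notation word := {ffun I -> 'I_N}.
Implicit Types (a b T : word) (s t p q : {perm I}).

Definition word_vec a : 'rV[F]_#|word| := delta_mx 0 (enum_rank a).

Definition wact_mx s : 'M[F]_#|word| := \matrix_i word_vec (wact (enum_val i) s).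

Lemma word_vecE a b : word_vec a 0 (enum_rank b) = (a == b)%:R.
Proof. by rewrite mxE eqxx (inj_eq enum_rank_inj) eq_sym. Qed.

Lemma word_vec_mul k a (A : 'M[F]_(_, k)) : word_vec a *m A = row (enum_rank a) A.
Proof. by rewrite rowE. Qed.

Lemma word_vec_act a s : word_vec a *m wact_mx s = word_vec (wact a s).
Proof. by rewrite word_vec_mul rowK enum_rankK. Qed.

Lemma word_vec_ext k (A B : 'M[F]_(_, k)) :
  (forall a, word_vec a *m A = word_vec a *m B) -> A = B.
Proof.
move=> E; apply/row_matrixP => i; rewrite -(enum_valK i).
by have := E (enum_val i); rewrite !word_vec_mul.
Qed.

(** The factors are reversed because words carry a left action while the matrices act on row vectors
    from the right. *)
Lemma wact_mxM s t : wact_mx (s * t)%g = wact_mx t *m wact_mx s.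
Proof. by apply: word_vec_ext => a; rewrite mulmxA !word_vec_act wactM. Qed.

End WordModule.
Arguments word_vec F {I N} a.
Arguments wact_mx F {I} N s.

Section SpechtModule.
Variables (F : numFieldType) (I : finType) (N : nat) (rw cl : I -> nat).
(** The coordinates [rw] and [cl] identify [I] with a Young diagram: distinct cells have distinct
    positions, and the positions are closed under moving up or left. *)
Hypothesis cell_inj : forall x y, rw x = rw y -> cl x = cl y -> x = y.
Hypothesis cell_down : forall x i j, (i <= rw x)%N -> (j <= cl x)%N ->
  exists y, rw y = i /\ cl y = j.
Local Notation word := {ffun I -> 'I_N}.
Implicit Types (a b T : word) (s t p q : {perm I}).

Definition young_sym_mx : 'M[F]_#|word| :=
  \sum_(p in fstab rw) \sum_(q in fstab cl) (-1) ^+ odd_perm q *: wact_mx F N (p * q)%g.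

Definition ssyt T : bool :=
  [forall x : I, forall y : I,
     ((rw x == rw y) && (cl x <= cl y)%N ==> (T x <= T y)%N) &&
     ((cl x == cl y) && (rw x < rw y)%N ==> (T x < T y)%N)].

Lemma ssytP T : reflect
  ((forall x y, rw x = rw y -> (cl x <= cl y)%N -> (T x <= T y)%N) /\
   (forall x y, cl x = cl y -> (rw x < rw y)%N -> (T x < T y)%N)) (ssyt T).
Proof.
apply: (iffP forallP) => [H|[H1 H2] x].
  split=> x y e l; have /forallP/(_ y)/andP[/implyP h1 /implyP h2] := H x.
    by apply: h1; rewrite e eqxx.
  by apply: h2; rewrite e eqxx.
apply/forallP => y; apply/andP; split; apply/implyP => /andP[/eqP e l].
  exact: H1.
exact: H2.
Qed.

(** The analogue of a polytabloid: entries are antisymmetrised along columns, then symmetrised along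
    rows. *)
Definition polytab a := word_vec F a *m young_sym_mx.

Lemma polytabE a : polytab a =
  \sum_(p in fstab rw) \sum_(q in fstab cl)
    (-1) ^+ odd_perm q *: word_vec F (wact (wact a q) p).
Proof.
rewrite /polytab mulmx_sumr; apply: eq_bigr => p _.
rewrite mulmx_sumr; apply: eq_bigr => q _.
by rewrite -scalemxAr word_vec_act wactM.
Qed.

Lemma polytab_col a q : q \in fstab cl ->
  polytab (wact a q) = (-1) ^+ odd_perm q *: polytab a.
Proof.
move=> qC; rewrite !polytabE scaler_sumr; apply: eq_bigr => p _.
rewrite scaler_sumr [RHS](reindex_inj (mulIg q)) /=.
apply: eq_big => [q'|q' _]; first by rewrite groupMr.
rewrite scalerA odd_permM wactM; congr (_ *: _).
by case: (odd_perm q); case: (odd_perm q'); rewrite ?expr0 ?expr1 ?mulr1 ?mul1r ?mulrNN ?mul1r.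
Qed.

Lemma polytab_col_eq0 a x y : x != y -> cl x = cl y -> a x = a y ->
  polytab a = 0.
Proof.
move=> xy cxy axy; have := polytab_col a (tperm_fstab cxy).
rewrite odd_tperm xy /= expr1 scaleN1r.
have -> : wact a (tperm x y) = a.
  by apply/ffunP => z; rewrite ffunE; case: tpermP => [->|->|].
by move/eqP; rewrite -subr_eq0 opprK -mulr2n -scaler_nat scaler_eq0 pnatr_eq0 => /eqP.
Qed.

(* Two cells of one row that q sends into H can be exchanged on either side of
   q: the row symmetrizer absorbs the transposition, the sum over H changes
   sign. *)
Lemma garnir a (H : {set I}) :
  (forall q, q \in fstab cl -> exists x y,
     [/\ x != y, rw x = rw y, q x \in H & q y \in H]) ->
  \sum_(s : {perm I} | perm_on H s) (-1) ^+ odd_perm s *: polytab (wact a s) = 0.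
Proof.
move=> Hq.
under eq_bigr => s _ do rewrite polytabE exchange_big scaler_sumr /=.
rewrite exchange_big big1 //= => q qC.
have [x [y [xy rxy qx qy]]] := Hq q qC.
pose t' := tperm (q x) (q y).
have t'H : perm_on H t'.
  apply/fintype.subsetP => z; rewrite inE; apply: contraR => zH.
  by rewrite /t' tpermD //; apply: contraNneq zH => <-.
pose S s : 'rV[F]_#|word| := \sum_(p in fstab rw) word_vec F (wact (wact (wact a s) q) p).
have St s : S (t' * s)%g = S s.
  rewrite /S [RHS](reindex_inj (mulIg (tperm x y))) /=.
  apply: eq_big => [p|p _]; first by rewrite groupMr // tperm_fstab.
  rewrite -!wactM; congr (word_vec F (wact _ _)).
  have E : (q * t' = tperm x y * q)%g by rewrite /t' -tpermJ -conjgC.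
  by rewrite -!mulgA (mulgA q t') E -!mulgA.
pose X := \sum_(s : {perm I} | perm_on H s) (-1) ^+ odd_perm s *: S s.
have XX : X = - X.
  rewrite {1}/X (reindex_inj (mulgI t')) /= -sumrN.
  apply: eq_big => [s|s _].
    apply/idP/idP => sH; last exact: perm_onM.
    by rewrite -[s](mulKg t') perm_onM // /t' tpermV.
  rewrite St odd_permM odd_tperm (inj_eq perm_inj) xy /= -scaleNr; congr (_ *: _).
  by case: (odd_perm s); rewrite ?expr0 ?expr1 ?opprK.
transitivity ((-1) ^+ odd_perm q *: X).
  rewrite /X scaler_sumr; apply: eq_bigr => s _; rewrite /S !scaler_sumr.
  by apply: eq_bigr => p _; rewrite !scalerA mulrC.
move/eqP: XX; rewrite -subr_eq0 opprK -mulr2n -scaler_nat scaler_eq0 pnatr_eq0 /=.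
by move/eqP->; rewrite scaler0.
Qed.


(** * Straightening by Garnir relations *)

Let cell i j z : I := odflt z [pick u | (rw u == i) && (cl u == j)].

Let cellP x i j z : (i <= rw x)%N -> (j <= cl x)%N ->
  rw (cell i j z) = i /\ cl (cell i j z) = j.
Proof.
move=> ix jx; rewrite /cell; case: pickP => [u /andP[/eqP ? /eqP ?] //|none].
have [u [ru cu]] := cell_down ix jx.
by have := none u; rewrite ru cu !eqxx.
Qed.

(** The Garnir belt for [x] and [y] in one row: the column of [x] from [x] downwards and the column
    of [y] from the top down to [y]. *)
Definition garnir_set x y : {set I} :=
  [set z | (cl z == cl x) && (rw x <= rw z)%N || (cl z == cl y) && (rw z <= rw x)%N].

(* A Garnir set has one more cell than the longer of its two columns. *)
Lemma garnir_set_collision x y q : rw x = rw y -> (cl x < cl y)%N ->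
  q \in fstab cl -> exists u v,
    [/\ u != v, rw u = rw v, q u \in garnir_set x y & q v \in garnir_set x y].
Proof.
move=> rxy cxy /fstabP qC; set H := garnir_set x y.
have [/dinjectiveP inj|] := boolP (dinjectiveb rw (q @^-1: H)); last first.
  case/dinjectivePn => u uK [v /andP[vu vK] ruv].
  exists u, v; rewrite eq_sym vu; split=> //.
    by move: uK; rewrite inE.
  by move: vK; rewrite inE.
exfalso; pose Col := [set z | cl z == cl x].
have yH : y \in H by rewrite inE rxy leqnn eqxx orbT.
(* As [q] preserves columns, every cell of the preimage of [H] can slide left into the column of
   [x]; with all rows distinct this is injective. *)
have le1 : (#|H| <= #|Col|)%N.
  rewrite -(card_preimset _ (@perm_inj _ q)).
  pose f z := cell (rw z) (cl x) z.
  have fP z : z \in q @^-1: H -> rw (f z) = rw z /\ cl (f z) = cl x.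
    rewrite !inE qC => zK; apply: (@cellP z) => //.
    by case/orP: zK => /andP[/eqP-> _] //; exact: ltnW.
  rewrite -(@card_in_imset _ _ f) => [|u v uK vK fuv].
    apply/subset_leq_card/fintype.subsetP => _ /imsetP[z zK ->].
    by rewrite inE; have [_ ->] := fP z zK; rewrite eqxx.
  by apply: inj => //; have [<- _] := fP u uK; have [<- _] := fP v vK; rewrite fuv.
(* Conversely, the cells of that column above [x] slide right into the column of [y] and the others
   stay; neither kind reaches [y]. *)
have le2 : (#|Col| <= #|H :\ y|)%N.
  pose f z := if (rw x <= rw z)%N then z else cell (rw z) (cl y) z.
  have fP z : z \in Col -> rw (f z) = rw z /\
      cl (f z) = if (rw x <= rw z)%N then cl x else cl y.
    rewrite inE /f => /eqP zC; case: leqP => // lt.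
    by apply: (@cellP y) => //; rewrite -rxy ltnW.
  rewrite -(@card_in_imset _ _ f) => [|u v uC vC fuv].
    apply/subset_leq_card/fintype.subsetP => _ /imsetP[z zC ->].
    have [r c] := fP z zC; rewrite !inE r c; case: leqP => lt.
      rewrite eqxx /= andbT; apply: contraTneq cxy => fzy.
      by rewrite -fzy c lt ltnn.
    rewrite eqxx /= (ltnW lt) orbT andbT.
    by apply: contraTneq lt => fzy; rewrite -r fzy rxy ltnn.
  have [ru _] := fP u uC; have [rv _] := fP v vC.
  apply: cell_inj; first by rewrite -ru -rv fuv.
  by move: uC vC; rewrite !inE => /eqP-> /eqP->.
by have := leq_trans le1 le2; rewrite (cardsD1 y H) yH ltnn.
Qed.

Definition ssyt_mx : 'M[F]_(#|[set T | ssyt T]|, _) :=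
  \matrix_i polytab (enum_val i).

Lemma weight_bound w a : (weight w a <= \sum_x w x * N)%N.
Proof. by apply: leq_sum => x _; rewrite leq_mul2l ltnW ?orbT // ltn_ord. Qed.

(* Each straightening step moves large entries to later columns. *)
Lemma polytab_sub a : (polytab a <= ssyt_mx)%MS.
Proof.
(* Induction on the distance of the column weight from its bound in [weight_bound]. *)
have [k] := ubnP ((\sum_x cl x * N) - weight cl a)%N.
elim: k => // k IH in a *; rewrite ltnS => lek.
have [/existsP[x /existsP[y /and3P[xy /eqP cxy /eqP axy]]]|/existsPn inj] :=
    boolP [exists x, [exists y, [&& x != y, cl x == cl y & a x == a y]]].
  by rewrite (polytab_col_eq0 xy cxy axy) sub0mx.
(* Sort the columns by maximising the row weight over column permutations. This changes [polytab a]
   by a sign only and keeps the column weight; as the entries of a column are distinct, the columns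
   of [b] increase strictly. *)
have [q qC qmax] := @arg_maxnP _ 1%g (mem (fstab cl))
  (fun q => weight rw (wact a q)) (group1 (fstab_group cl)).
set b := wact a q.
suff bB : (polytab b <= ssyt_mx)%MS.
  have -> : polytab a = (-1) ^+ odd_perm q *: polytab b.
    by rewrite (polytab_col _ qC) scalerA -expr2 sqrr_sign scale1r.
  exact: scalemx_sub.
have {}lek : (\sum_x cl x * N - weight cl b <= k)%N by rewrite weight_fstab.
have bcol x y : cl x = cl y -> (rw x < rw y)%N -> (b x < b y)%N.
  move=> cxy rxy; rewrite ltn_neqAle (weight_max_nondec qC qmax cxy rxy) andbT.
  have /existsPn/(_ (q y)) := inj (q x).
  rewrite (inj_eq perm_inj) !(fstabP _ _ qC) cxy eqxx !ffunE /=.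
  by case: eqVneq rxy => [->|_ _]; rewrite ?ltnn.
have [bS|/forallPn[x]] := boolP (ssyt b).
  have bS' : b \in [set T | ssyt T] by rewrite inE.
  apply: (eq_row_sub (enum_rank_in bS' b)).
  by rewrite rowK enum_rankK_in.
case/forallPn => y; rewrite negb_and !negb_imply -!ltnNge ltnS.
case/orP=> [/andP[/andP[/eqP rxy cxy] byx]|]; last first.
  by case/andP=> /andP[/eqP cxy rxy]; rewrite leqNgt bcol.
have {}cxy : (cl x < cl y)%N.
  rewrite ltn_neqAle cxy andbT; apply: contraTneq byx => e.
  by rewrite (cell_inj rxy e) ltnn.
have /eqP := garnir b (fun q => garnir_set_collision rxy cxy (q := q)).
set H := garnir_set x y.
(* In the Garnir relation each column-preserving [s] contributes [polytab b], the two signs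
   cancelling; dividing by their number expresses [polytab b] through the other terms. *)
rewrite (bigID (mem (fstab cl))) /=.
rewrite (eq_bigr (fun=> polytab b)) => [|s /andP[_ sC]]; last first.
  by rewrite (polytab_col _ sC) scalerA -expr2 sqrr_sign scale1r.
rewrite sumr_const -scaler_nat addr_eq0 => /eqP E.
set m := #|_| in E; have m0 : (0 < m)%N.
  by apply/card_gt0P; exists 1%g; rewrite unfold_in perm_on1 (group1 (fstab_group cl)).
have -> : polytab b = m%:R^-1 *: (m%:R *: polytab b).
  by rewrite scalerA mulVf ?scale1r // pnatr_eq0 -lt0n.
rewrite E scalemx_sub // eqmx_opp summx_sub // => s /andP[sH sC].
apply/scalemx_sub/IH.
suff : (weight cl b < weight cl (wact b s))%N.
  by have := weight_bound cl (wact b s); lia.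
(* The threshold [b y] separates the belt: by column monotonicity its cells in the column of [x]
   carry entries at least [b x], above [b y], and those in the column of [y] entries at most
   [b y]. *)
apply: (@weight_lt _ _ _ _ _ (b y)); last first.
  move: sC; rewrite inE => /forallPn[z]; rewrite -{2}[z](permK s) => ne.
  by exists (s z).
have bge u v : cl u = cl v -> (rw u <= rw v)%N -> (b u <= b v)%N.
  move=> cuv; rewrite leq_eqVlt => /orP[/eqP ruv|ruv].
    by rewrite (cell_inj ruv cuv).
  exact/ltnW/bcol.
move=> z; set u := (s^-1)%g z => ne.
have zs : z = s u by rewrite /u permKV.
have uH : u \in H.
  by apply: contraR ne => uH; rewrite zs (out_perm sH uH).
have : z \in H by rewrite zs perm_closed.
move: uH ne; rewrite !inE.
case/orP=> /andP[/eqP cu ru] ne /orP[] /andP[/eqP cz rz]; move: ne;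
  rewrite cu cz ?eqxx // => _.
  by rewrite (ltnNge (b y)) (bge z y) // ?rz -?rxy // ltnNge ltnW.
by rewrite cxy (leq_trans byx) // bge.
Qed.

(** * Linear independence of the semistandard images *)

(** A column permutation of maximal row weight sorts the columns, so it fixes [T] by
    [nondec_unique]; as the columns of [T] have distinct entries, it is trivial. Hence 1 is the only
    maximiser. *)
Lemma ssyt_col_weight T q : ssyt T -> q \in fstab cl -> q != 1%g ->
  (weight rw (wact T q) < weight rw T)%N.
Proof.
move=> /ssytP[_ Tcol] qC q1.
have [q0 q0C qmax] := @arg_maxnP _ 1%g (mem (fstab cl))
  (fun q => weight rw (wact T q)) (group1 (fstab_group cl)).
have uniq s : s \in fstab cl ->
    (forall t, t \in fstab cl -> (weight rw (wact T t) <= weight rw (wact T s))%N) ->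
    s = 1%g.
  move=> sC smax.
  have Tle (f : word) : (forall x y, cl x = cl y -> (rw x < rw y)%N -> (f x <= f y)%N) ->
      nondec_along cl rw f.
    move=> H x y cxy; rewrite leq_eqVlt => /orP[/eqP rxy|]; last exact: H.
    by rewrite (cell_inj rxy cxy).
  have E : wact T s = T.
    apply: (nondec_unique sC); apply: Tle => x y cxy rxy; first exact/ltnW/Tcol.
    exact: (weight_max_nondec sC smax).
  apply/permP => x; rewrite perm1.
  have cs := fstabP _ _ sC x; apply: cell_inj => //.
  have Ex : T (s x) = T x by rewrite -[in RHS]E ffunE.
  by case: (ltngtP (rw (s x)) (rw x)) => // lt;
    have := Tcol _ _ _ lt; rewrite cs Ex ltnn => /(_ erefl).
rewrite ltnNge; apply: contra q1 => le.
have q01 := uniq q0 q0C qmax; apply/eqP/uniq => // t tC.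
by apply: leq_trans (qmax _ tC) _; rewrite q01 wact1.
Qed.

(* T is the word of largest row weight in its column orbit, and the only one. *)
Lemma polytab_triangular T T0 : ssyt T -> ssyt T0 ->
  polytab T 0 (enum_rank T0) != 0 -> (weight rw T <= weight rw T0)%N -> T = T0.
Proof.
move=> sT sT0 nz le.
have /exists_inP[p pR /exists_inP[q qC /eqP E]] :
    [exists p in fstab rw, exists q in fstab cl, wact (wact T q) p == T0].
  apply: contraNT nz => none.
  rewrite polytabE summxE big1 // => p pR; rewrite summxE big1 // => q qC.
  rewrite mxE word_vecE; case: eqP => [E|_]; last by rewrite mulr0.
  case/negP: none; apply/exists_inP; exists p => //.
  by apply/exists_inP; exists q => //; apply/eqP.
(* A nontrivial [q] would lower the row weight strictly, and [p] preserves it. What remains is a row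
   rearrangement between two row-sorted words. *)
have q1 : q = 1%g.
  apply: contraTeq le => q1; rewrite -ltnNge -E weight_fstab //.
  exact: ssyt_col_weight.
move: E; rewrite q1 wact1 => E; rewrite -E in sT0 *; symmetry.
by apply: (nondec_unique (w := cl) pR); [have /ssytP[] := sT | have /ssytP[] := sT0].
Qed.

(** By [ssyt_col_weight] only [q = 1] can lead back to [T], so the coefficient counts the row
    permutations fixing [T], without cancellation. *)
Lemma polytab_diag T : ssyt T -> polytab T 0 (enum_rank T) != 0.
Proof.
move=> sT; rewrite polytabE summxE.
rewrite (eq_bigr (fun p => (wact T p == T)%:R)) => [|p pR].
  apply: lt0r_neq0; rewrite (bigD1 1%g) ?group1 //= wact1 eqxx.
  by apply: ltr_pwDl => //; apply: sumr_ge0 => p _; apply: ler0n.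
rewrite summxE (bigD1 1%g) ?group1 //= mxE word_vecE odd_perm1 wact1 mul1r.
rewrite big1 ?addr0 // => q /andP[qC q1]; rewrite mxE word_vecE.
have := ssyt_col_weight sT qC q1; case: eqP => [E|_]; last by rewrite mulr0.
by rewrite -[X in (_ < weight rw X)%N]E (weight_fstab _ pR) ltnn.
Qed.

(** In a vanishing combination, take a tableau of largest row weight among those with nonzero
    coefficient: by triangularity no other term contributes at its word. *)
Lemma ssyt_mx_free : row_free ssyt_mx.
Proof.
apply: inj_row_free => w w0; apply/rowP => i; rewrite mxE.
apply/eqP; apply: contraT => wi.
have [j wj jmax] := @arg_maxnP _ i (fun j => w 0 j != 0)
  (fun j => weight rw (enum_val j)) wi.
have ssT (k : 'I_#|[set T | ssyt T]|) : ssyt (enum_val k : word)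
  by have := enum_valP k; rewrite inE.
have := congr1 (fun v : 'rV_#|word| => v 0 (enum_rank (enum_val j))) w0.
rewrite mulmx_sum_row summxE (bigD1 j) //= rowK mxE [RHS]mxE big1 ?addr0 => [/eqP|k kj].
  by rewrite mulf_eq0 (negbTE wj) (negbTE (polytab_diag _)).
rewrite rowK mxE; have [->|wk] := eqVneq (w 0 k) 0; first by rewrite mul0r.
have [->|nz] := eqVneq (polytab (enum_val k) 0 (enum_rank (enum_val j))) 0.
  by rewrite mulr0.
by case/eqP: kj; apply/enum_val_inj/polytab_triangular => //; apply: jmax.
Qed.

Definition word_diag (x : 'I_N -> F) : 'M[F]_#|word| :=
  diag_mx (\row_i \prod_l x ((enum_val i : word) l)).

Lemma word_vec_diag x a : word_vec F a *m word_diag x = (\prod_l x (a l)) *: word_vec F a.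
Proof.
rewrite word_vec_mul row_diag_mx mxE enum_rankK; congr (_ *: _).
Qed.

Lemma wact_mx_diag x s : wact_mx F N s *m word_diag x = word_diag x *m wact_mx F N s.
Proof.
apply: word_vec_ext => a; rewrite !mulmxA word_vec_act !word_vec_diag -scalemxAl word_vec_act.
congr (_ *: _); rewrite [RHS](reindex_inj (@perm_inj _ s)) /=.
by apply: eq_bigr => l _; rewrite ffunE.
Qed.

(** The assumptions say that [P] maps into the row space of the Young symmetrizer and is the
    identity there. The semistandard [polytab] vectors form a basis of this space, on which the
    diagonal operator acts with the tableau monomials as eigenvalues. *)
Lemma trace_young_sym_image (x : 'I_N -> F) (P A : 'M[F]_#|word|) :
  P = A *m young_sym_mx -> young_sym_mx *m P = young_sym_mx ->
  \tr (P *m word_diag x) = \sum_(T | ssyt T) \prod_l x (T l).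
Proof.
move=> PA yP; set B := ssyt_mx.
have [W PW] : exists W, P = W *m B.
  apply/submxP; apply/row_subP => i; rewrite PA row_mul mulmx_sum_row.
  apply: summx_sub => j _; apply: scalemx_sub.
  by rewrite -(enum_valK j) -word_vec_mul polytab_sub.
have BS : B = (\matrix_i word_vec F (enum_val i)) *m young_sym_mx.
  by apply/row_matrixP => i; rewrite row_mul !rowK.
have BP : B *m P = B by rewrite BS -mulmxA yP.
have BW : B *m W = 1%:M.
  by apply: (row_free_inj ssyt_mx_free); rewrite -mulmxA -PW BP mul1mx.
pose d := diag_mx (\row_i \prod_l x ((enum_val i : word) l)) : 'M[F]_#|[set T | ssyt T]|.
have yD : young_sym_mx *m word_diag x = word_diag x *m young_sym_mx.
  rewrite mulmx_suml mulmx_sumr; apply: eq_bigr => p _.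
  rewrite mulmx_suml mulmx_sumr; apply: eq_bigr => q _.
  by rewrite -scalemxAl -scalemxAr wact_mx_diag.
have BD : B *m word_diag x = d *m B.
  apply/row_matrixP => i; rewrite row_mul rowK row_mul row_diag_mx -scalemxAl.
  by rewrite -rowE rowK mxE /polytab -mulmxA yD mulmxA word_vec_diag -scalemxAl.
rewrite PW -mulmxA mxtrace_mulC BD -mulmxA BW mulmx1.
rewrite mxtrace_diag (eq_bigr (fun i => \prod_l x ((enum_val i : word) l))).
  by rewrite -(big_enum_val (fun T : word => \prod_l x (T l)));
    apply: eq_bigl => T; rewrite inE.
by move=> i _; rewrite mxE.
Qed.

End SpechtModule.

(** * The Frobenius formula *)

(** Since [p] maps into [U] and is the identity on it, the trace over [U] can be computed in the
    ambient space. *)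
Lemma mxtrace_submod_repr (F : fieldType) (gT : finGroupType) (G : {group gT})
    (n : nat) (rG : mx_representation F G n) (U p : 'M[F]_n) (modU : mxmodule rG U) s :
  s \in G -> (p <= U)%MS -> U *m p = U -> \tr (submod_repr modU s) = \tr (rG s *m p).
Proof.
move=> Gs pU Up; set B : 'M[F]_(\rank U, n) := val_submod 1%:M.
have BU : (B <= U)%MS by apply: val_submodP.
have Bp : B *m p = B by have /submxP[X ->] := BU; rewrite -mulmxA Up.
have pE : p = in_submod U p *m B by rewrite -val_submodE in_submodK.
have BW : B *m in_submod U p = 1%:M.
  apply: (@val_submod_inj _ _ U).
  by rewrite val_submodE -mulmxA -/B -pE Bp /B.
rewrite [in RHS]pE mulmxA (mxtrace_mulC (rG s *m _)) mulmxA.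
rewrite -[submod_repr modU s]mulmx1 -BW mulmxA.
rewrite /= /submod_mx -/B -[in LHS]/B.
rewrite -[in_submod U (B *m _) *m B]val_submodE in_submodK //.
exact: mxmodule_trans.
Qed.

Lemma maschke_projector (F : numFieldType) (gT : finGroupType) (G : {group gT})
    (n : nat) (rG : mx_representation F G n) (U : 'M[F]_n) : mxmodule rG U ->
  exists p, [/\ (p <= U)%MS, U *m p = U &
    forall x, x \in G -> rG x *m p = p *m rG x].
Proof.
move=> modU.
have F'G : ([pchar F]^'.-group G)%g.
  by rewrite /pgroup pcharf'_nat pnatr_eq0 -lt0n cardG_gt0.
have [W modW defV /mxdirect_addsP dx] := mx_Maschke_pchar rG F'G modU (submx1 U).
exists (proj_mx U W); split=> [||x Gx].
- by rewrite -[proj_mx U W]mul1mx proj_mx_sub.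
- exact: proj_mx_id.
have /hom_mxP/(_ x Gx) := proj_mx_hom dx modU modW.
(* [proj_mx_hom] gives commutation on [U + W], which is the whole space. *)
have /submxP[X X1] : (1%:M <= U + W)%MS by rewrite defV.
by move/(congr1 (mulmx X)); rewrite !mulmxA -X1 !mul1mx.
Qed.

(** * The group algebra acting on words *)

Section RegularRepr.
Variables (F : numFieldType) (I : finType) (N : nat).
Local Notation G := [set: {perm I}]%G.
Local Notation aG := (regular_repr F G).
Local Notation gi := (gring_index G).
Local Notation word := {ffun I -> 'I_N}.

(** The linear extension of [wact_mx] to the group algebra, whose elements are rows of coefficients;
    the form as a composite of linear maps supplies its linear structure. *)
Definition word_op (v : 'rV[F]_#|G|) : 'M[F]_#|word| :=
  vec_mx (v *m \matrix_i mxvec (wact_mx F N (enum_val i : {perm I}))).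
HB.instance Definition _ := GRing.Linear.copy word_op (vec_mx \o mulmxr _).

Lemma word_opE v : word_op v = \sum_(s : {perm I}) v 0 (gi s) *: wact_mx F N s.
Proof.
rewrite /word_op mulmx_sum_row linear_sum /=.
rewrite (reindex gi) /=; last first.
  by exists enum_val => i _; [rewrite gring_indexK ?inE|rewrite gring_valK].
by apply: eq_bigr => s _; rewrite rowK linearZ /= mxvecK gring_indexK ?inE.
Qed.

Lemma word_op_delta s : word_op (delta_mx 0 (gi s)) = wact_mx F N s.
Proof. by rewrite /word_op -rowE rowK mxvecK gring_indexK ?inE. Qed.

Lemma gring_index_inj : injective gi.
Proof. by move=> s t /(congr1 enum_val); rewrite !gring_indexK ?inE. Qed.

Lemma regular_mulE (v : 'rV_#|G|) g s : (v *m aG g) 0 (gi s) = v 0 (gi (s * g^-1)%g).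
Proof.
rewrite mxE (bigD1 (gi (s * g^-1)%g)) //= !mxE gring_indexK ?inE // mulgKV.
rewrite !eqxx mulr1 big1 ?addr0 // => i ne; rewrite !mxE eqxx /=.
case: eqP => [/gring_index_inj E|_]; last by rewrite mulr0.
by case/eqP: ne; rewrite E mulgK gring_valK.
Qed.

(** Right translation turns into left multiplication because [wact_mx] reverses products. *)
Lemma word_op_regular v g : word_op (v *m aG g) = wact_mx F N g *m word_op v.
Proof.
rewrite !word_opE mulmx_sumr (reindex_inj (mulIg g)) /=; apply: eq_bigr => s _.
by rewrite regular_mulE mulgK wact_mxM scalemxAr.
Qed.

Lemma tr_wact_mx_diag (x : 'I_N -> F) s :
  \tr (wact_mx F N s *m word_diag I x) = \sum_(a : word | wact a s == a) \prod_l x (a l).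
Proof.
rewrite /mxtrace (reindex enum_rank) /=; last first.
  by exists enum_val => i _; [rewrite enum_rankK|rewrite enum_valK].
rewrite [RHS]big_mkcond; apply: eq_bigr => a _.
have -> (A : 'M[F]_#|word|) :
    A (enum_rank a) (enum_rank a) = (word_vec F a *m A) 0 (enum_rank a).
  by rewrite word_vec_mul mxE.
rewrite mulmxA word_vec_act word_vec_diag mxE word_vecE.
by case: eqP => [->|_]; rewrite ?mulr1 ?mulr0.
Qed.

End RegularRepr.

Section Frobenius.
Variables (F : numFieldType) (I : finType) (N : nat) (rw cl : I -> nat).
Hypothesis cell_inj : forall x y, rw x = rw y -> cl x = cl y -> x = y.
Hypothesis cell_down : forall x i j, (i <= rw x)%N -> (j <= cl x)%N ->
  exists y, rw y = i /\ cl y = j.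
Local Notation G := [set: {perm I}]%G.
Local Notation aG := (regular_repr F G).
Local Notation gi := (gring_index G).
Local Notation word := {ffun I -> 'I_N}.

Definition young_sym_row : 'rV[F]_#|G| :=
  \sum_(p in fstab rw) \sum_(q in fstab cl)
    (-1) ^+ odd_perm q *: delta_mx 0 (gi (p * q)%g).

Lemma word_op_young_sym : word_op N young_sym_row = young_sym_mx F N rw cl.
Proof.
rewrite linear_sum; apply: eq_bigr => p _; rewrite linear_sum.
by apply: eq_bigr => q _; rewrite linearZ /= word_op_delta.
Qed.

(** With coordinates read off from a partition, this is convertible to [specht_char]. *)
Definition young_char (s : {perm I}) : F :=
  \tr (submod_repr (cyclic_mx_module aG young_sym_row) s).

Lemma sum_perm_word_eq (x : 'I_N -> F) s :
  \sum_(a : word | wact a s^-1%g == a) \prod_l x (a l) =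
  \sum_(a : word | wact a s == a) \prod_l x (a l).
Proof.
apply: eq_bigl => a; apply/eqP/eqP => E.
  by rewrite -{1}E wactVK.
by rewrite -{1}E wactK.
Qed.

Lemma sum_perm_word_conj (x : 'I_N -> F) s g :
  \sum_(a : word | wact a (s ^ g)%g == a) \prod_l x (a l) =
  \sum_(a : word | wact a s == a) \prod_l x (a l).
Proof.
rewrite (reindex_inj (can_inj (@wactVK _ _ g))) /=.
apply: eq_big => [a|a _]; last first.
  rewrite [RHS](reindex_inj (@perm_inj _ g^-1%g)) /=.
  by apply: eq_bigr => l _; rewrite ffunE.
by rewrite -wactM conjgE mulgA mulgK wactM (inj_eq (can_inj (@wactVK _ _ g))).
Qed.

Lemma frobenius_ssyt (x : 'I_N -> F) :
  \sum_s young_char s * \sum_(a : word | wact a s == a) \prod_l x (a l) =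
  ((#|I|)`!)%:R * \sum_(T : word | ssyt rw cl T) \prod_l x (T l).
Proof.
set e := young_sym_row; set U := cyclic_mx aG e.
have [p [pU Up pC]] := maschke_projector (cyclic_mx_module aG e).
set f := row (gi 1%g) p.
(* As [p] commutes with right translations, it is left multiplication by [f], the image of 1. *)
have pE g : delta_mx 0 (gi g) *m p = f *m aG g.
  rewrite /f rowE -mulmxA -pC ?inE // mulmxA -[_ *m aG g]rowE /= rowK.
  by rewrite gring_indexK ?inE // mul1g.
pose X s : F := \sum_(a : word | wact a s == a) \prod_l x (a l).
have chiE s : young_char s = \sum_g f 0 (gi (g * (g * s)^-1)%g).
  rewrite /young_char (mxtrace_submod_repr _ (finset.in_setT s) pU Up) /mxtrace.
  rewrite (reindex gi) /=; last first.
    by exists enum_val => i _; [rewrite gring_indexK ?inE|rewrite gring_valK].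
  apply: eq_bigr => g _.
  transitivity (row (gi g) (aG s *m p) 0 (gi g)); first by rewrite [RHS]mxE.
  by rewrite row_mul /= rowK gring_indexK ?inE // pE regular_mulE.
(* [X] is invariant under conjugation and inversion, so every [g] in the trace contributes the same
   sum. *)
transitivity (\sum_(g : {perm I}) \sum_s f 0 (gi s) * X s).
  rewrite (eq_bigr _ (fun s _ => congr1 ( *%R^~ _) (chiE s))).
  under eq_bigr => s _ do rewrite mulr_suml.
  rewrite exchange_big /=; apply: eq_bigr => g _.
  rewrite (reindex_inj (can_inj (@invgK _))) (reindex_inj (conjg_inj g)) /=.
  apply: eq_bigr => s _; rewrite -/(X _); congr (f 0 (gi _) * _).
    by rewrite invMg invgK conjgE -!mulgA mulgV mulg1 mulKVg.
  by rewrite /X sum_perm_word_eq sum_perm_word_conj.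
have -> : (#|I|)`! = #|{perm I}|.
  rewrite -[#|I|]cardsT -card_perm; apply: eq_card => s.
  by rewrite unfold_in; apply/fintype.subsetP => y _; rewrite inE.
rewrite sumr_const -[LHS]mulr_natl; congr (_ * _).
have fE : word_op N f = \sum_(s : {perm I}) f 0 (gi s) *: wact_mx F N s by exact: word_opE.
transitivity (\tr (word_op N f *m word_diag I x)).
  rewrite fE mulmx_suml linear_sum; apply: eq_bigr => s _.
  by rewrite -scalemxAl linearZ /= tr_wact_mx_diag.
(* Two relations are extracted: [f] lies in the right ideal of [e], and [f] times [e] is [e]. As
   [word_op] reverses products, they become the assumptions of [trace_young_sym_image]. *)
have [A EA fA] : exists2 A, (A \in enveloping_algebra_mx aG)%MS & f = e *m A.
  apply/cyclic_mxP; apply: submx_trans pU; exact: row_sub.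
have /envelop_mxP[c AE] := EA.
have eE : e = \sum_(g : {perm I}) e 0 (gi g) *: (f *m aG g).
  have ep : e *m p = e.
    by have /submxP[Y eY] := cyclic_mx_id aG e; rewrite eY -mulmxA Up.
  rewrite -{1}ep mulmx_sum_row (reindex gi) /=; last first.
    by exists enum_val => i _; [rewrite gring_indexK ?inE|rewrite gring_valK].
  by apply: eq_bigr => g _; rewrite rowE pE.
apply: (@trace_young_sym_image F I N rw cl cell_inj cell_down x _
  (\sum_(g in G) c g *: wact_mx F N g)).
  rewrite fA AE mulmx_sumr linear_sum mulmx_suml; apply: eq_bigr => g _.
  by rewrite -scalemxAr linearZ /= word_op_regular word_op_young_sym scalemxAl.
rewrite -word_op_young_sym -/e [in RHS]eE (word_opE N e) linear_sum mulmx_suml.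
apply: eq_bigr => g _.
by rewrite linearZ /= word_op_regular scalemxAl.
Qed.
End Frobenius.

(** * Traces of permuted tensor powers in terms of eigenvalues *)

(** This is the trace of [tensor_op M] composed with [perm_op] of the inverse of [s]; the factors
    may differ, as polarization requires. *)
Definition perm_trace (R : comPzRingType) (I : finType) (N : nat) (s : {perm I})
    (M : I -> 'M[R]_N) : R :=
  \sum_(a : {ffun I -> 'I_N}) \prod_l M l (a l) (a (s l)).

(** Cyclicity of the trace, combined with the fact that a tensor power of one matrix commutes with
    permutations. It allows replacing [h] by a conjugate. *)
Lemma perm_trace_mulC (R : comPzRingType) (I : finType) (N : nat) (s : {perm I})
    (A B : 'M[R]_N) : perm_trace s (fun=> A *m B) = perm_trace s (fun=> B *m A).
Proof.
have expand (X Y : 'M[R]_N) : perm_trace s (fun=> X *m Y) =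
    \sum_(a : {ffun I -> 'I_N}) \sum_(c : {ffun I -> 'I_N})
      (\prod_l X (a l) (c l)) * \prod_l Y (c l) (a (s l)).
  apply: eq_bigr => a _; under eq_bigr => l _ do rewrite mxE.
  by rewrite bigA_distr_bigA; apply: eq_bigr => c _; rewrite big_split.
rewrite !expand exchange_big; apply: eq_bigr => c _.
rewrite [RHS](reindex_inj (can_inj (@wactK _ _ s))) /=; apply: eq_bigr => a _.
rewrite mulrC; congr (_ * _); first by apply: eq_bigr => l _; rewrite ffunE.
rewrite (reindex_inj (@perm_inj _ s)) /=.
by apply: eq_bigr => l _; rewrite ffunE.
Qed.

Lemma perm_trace_trig (R : comPzRingType) (I : finType) (N : nat) (s : {perm I})
    (T : 'M[R]_N) : is_trig_mx T ->
  perm_trace s (fun=> T) = \sum_(a : {ffun I -> 'I_N} | wact a s == a) \prod_l T (a l) (a l).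
Proof.
move=> /is_trig_mxP trigT; rewrite [RHS]big_mkcond; apply: eq_bigr => a _.
case: eqP => [E|/eqP ne].
  apply: eq_bigr => l _.
  by have -> : a (s l) = a l by rewrite -[in RHS]E ffunE.
have [/existsP[l lt]|/existsPn ge] := boolP [exists l, (a l < a (s l))%N].
  by rewrite (bigD1 l) //= trigT ?mul0r.
case/eqP: ne; apply/ffunP => l; rewrite ffunE; apply: val_inj.
(* The values only decrease along s but their sum is preserved. *)
have le k : (a (s k) <= a k)%N by rewrite leqNgt ge.
have [_] := leqif_sum (fun k (_ : true) => leqif_eq (le k)).
rewrite [X in X == _](_ : _ = \sum_l a l)%N; last first.
  by rewrite [RHS](reindex_inj (@perm_inj _ s)).
by rewrite eqxx => /esym/forallP/(_ l)/eqP.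
Qed.

Lemma trigonalize (C : numClosedFieldType) (N : nat) (h : 'M[C]_N) :
  exists P T : 'M[C]_N, [/\ P \in unitmx, is_trig_mx T & h = invmx P *m T *m P].
Proof.
case: N h => [|N] h.
  exists 1%:M, h; split; rewrite ?unitmx1 ?mulmx1 ?invmx1 ?mul1mx //.
  by apply/is_trig_mxP => -[].
have [P /unitarymx_unit uP] := Schur h (ltn0Sn N).
rewrite /similar_to conjumx // => trigT.
by exists P, (P *m h *m invmx P); rewrite uP trigT -!mulmxA mulVmx // mulmx1 mulKmx.
Qed.

Lemma char_poly_conj (R : comUnitRingType) (N : nat) (P T : 'M[R]_N) :
  P \in unitmx -> char_poly (invmx P *m T *m P) = char_poly T.
Proof.
move=> uP; rewrite /char_poly /char_poly_mx !map_mxM.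
set P1 := map_mx polyC P; set P2 := map_mx polyC (invmx P).
have P21 : P2 *m P1 = 1%:M by rewrite -map_mxM mulVmx // map_mx1.
have -> : 'X%:M - P2 *m map_mx polyC T *m P1 = P2 *m ('X%:M - map_mx polyC T) *m P1.
  rewrite mulmxBr mulmxBl; congr (_ - _).
  by rewrite scalar_mxC -mulmxA P21 mulmx1.
by rewrite !det_mulmx mulrAC -det_mulmx P21 det1 mul1r.
Qed.

(** After triangularisation only fixed words survive. The diagonal lists the eigenvalues, possibly
    in another order than [eigvals]; a permutation [p] of the letters reconciles the two. *)
Lemma perm_trace_eigvals (C : numClosedFieldType) (I : finType) (N : nat)
    (s : {perm I}) (h : 'M[C]_N) :
  perm_trace s (fun=> h) =
  \sum_(a : {ffun I -> 'I_N} | wact a s == a) \prod_l (eigvals h)`_(a l).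
Proof.
have [P [T [uP trigT hE]]] := trigonalize h.
rewrite {1}hE perm_trace_mulC mulmxA mulmxV // mul1mx perm_trace_trig //.
have pe : perm_eq (eigvals h) [tuple T i i | i < N].
  apply: prod_XsubC_eq; rewrite /eigvals; case: closed_field_poly_normal => r /=.
  rewrite (monicP (char_poly_monic h)) scale1r => <-.
  by rewrite hE char_poly_conj // char_poly_trig // big_map big_enum.
have [p pE] := tuple_permP pe.
have ex (i : 'I_N) : (eigvals h)`_i = T (p i) (p i).
  by rewrite pE -tnth_nth !tnth_mktuple.
pose f g (a : {ffun I -> 'I_N}) : {ffun I -> 'I_N} := [ffun l => (g : {perm 'I_N}) (a l)].
have fK g : cancel (f g) (f g^-1)%g by move=> a; apply/ffunP => l; rewrite !ffunE permK.
rewrite (reindex_inj (can_inj (fK p))) /=; apply: eq_big => a.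
  apply/eqP/eqP => /ffunP E; apply/ffunP => l; have := E l; rewrite !ffunE.
    by move/perm_inj.
  by move->.
by move=> _; apply: eq_bigr => l _; rewrite ex ffunE.
Qed.

(** * Young diagrams of partitions and Schur polynomials *)

Lemma diagram_inj (lam : seq nat) i j :
  reshape_index lam i = reshape_index lam j ->
  reshape_offset lam i = reshape_offset lam j -> i = j.
Proof. by move=> ri ro; rewrite -(reshape_indexK lam i) ri ro reshape_indexK. Qed.

Lemma diagram_down (lam : seq nat) k i j : sorted geq lam -> (k < sumn lam)%N ->
  (i <= reshape_index lam k)%N -> (j <= reshape_offset lam k)%N ->
  exists2 l, (l < sumn lam)%N & reshape_index lam l = i /\ reshape_offset lam l = j.
Proof.
move=> lam_sorted lek ir jc.
(* Row [i] is at least as long as the row of [k], since the parts weakly decrease. *)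
have lt : (j < nth 0%N lam i)%N.
  apply: leq_ltn_trans jc (leq_trans (reshape_offsetP lek) _).
  have gt : transitive geq by move=> a b c ab bc; exact: leq_trans bc ab.
  have rk := reshape_indexP lek.
  by apply: (sorted_leq_nth gt leqnn 0%N lam_sorted); rewrite ?inE //; apply: leq_ltn_trans rk.
exists (flatten_index lam i j); first exact: flatten_indexP.
by rewrite flatten_indexKl ?flatten_indexKr.
Qed.

Lemma frobenius_schur (C : numClosedFieldType) (lam : seq nat) (I : finType)
    (N : nat) (h : 'M[C]_N) : is_partition lam -> #|I| = sumn lam ->
  \sum_(s : {perm I}) specht_char C lam s * perm_trace s^-1%g (fun=> h) =
  (sumn lam)`!%:R * schur_mx lam h.
Proof.
move=> /andP[lam_sorted _] cardI.
pose rw (x : I) := reshape_index lam (enum_rank x).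
pose cl (x : I) := reshape_offset lam (enum_rank x).
have cell_inj x y : rw x = rw y -> cl x = cl y -> x = y.
  by move=> rxy cxy; apply/enum_rank_inj/val_inj; apply: diagram_inj rxy cxy.
have cell_down x i j : (i <= rw x)%N -> (j <= cl x)%N ->
    exists y, rw y = i /\ cl y = j.
  move=> ir jc; have ltx : (enum_rank x < sumn lam)%N by rewrite -cardI.
  have [l] := diagram_down lam_sorted ltx ir jc; rewrite -cardI => ltl E.
  by exists (enum_val (Ordinal ltl)); rewrite /rw /cl enum_valK.
pose x (i : 'I_N) := (eigvals h)`_i.
have := frobenius_ssyt (N := N) cell_inj cell_down x.
rewrite cardI => F.
transitivity (\sum_(s : {perm I}) young_char C rw cl s *
    \sum_(a : {ffun I -> 'I_N} | wact a s == a) \prod_l x (a l)).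
  by apply: eq_bigr => s _; rewrite perm_trace_eigvals (sum_perm_word_eq x).
rewrite F; congr (_ * _); rewrite /schur_mx /schur.
pose g (T : {ffun 'I_(sumn lam) -> 'I_N}) : {ffun I -> 'I_N} :=
  [ffun y => T (cast_ord cardI (enum_rank y))].
pose g' (T : {ffun I -> 'I_N}) : {ffun 'I_(sumn lam) -> 'I_N} :=
  [ffun k => T (enum_val (cast_ord (esym cardI) k))].
rewrite (reindex g) /=; last first.
  exists g' => T _; apply/ffunP => k; rewrite !ffunE.
    by rewrite enum_valK cast_ordKV.
  by rewrite cast_ordK enum_rankK.
have gE T k : g T (enum_val (cast_ord (esym cardI) k)) = T k.
  by rewrite ffunE enum_valK cast_ordKV.
apply: eq_big => [T|T _].
  apply/forallP/forallP => H.
    move=> p; apply/forallP => q.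
    have /forallP := H (enum_val (cast_ord (esym cardI) p)).
    by move/(_ (enum_val (cast_ord (esym cardI) q))); rewrite /rw /cl !gE !enum_valK.
  move=> y; apply/forallP => y'.
  have /forallP/(_ (cast_ord cardI (enum_rank y'))) := H (cast_ord cardI (enum_rank y)).
  by rewrite !ffunE.
rewrite (reindex (fun k => enum_val (cast_ord (esym cardI) k))) /=; last first.
  exists (fun y => cast_ord cardI (enum_rank y)) => y _.
    by rewrite enum_valK cast_ordKV.
  by rewrite cast_ordK enum_rankK.
by apply: eq_bigr => k _; rewrite gE.
Qed.

(** * Polarization *)

Section MixedDerivative.
Import numFieldNormedType.Exports.

Lemma is_derive_horner (R : numFieldType) (p : {poly R}) (x : R) :
  is_derive x 1 (horner p) (p^`()).[x].
Proof.
elim/poly_ind: p => [|p r IH].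
  rewrite (_ : horner 0 = cst 0); last by apply/funext => y; rewrite horner0.
  by rewrite deriv0 horner0; apply: is_derive_cst.
rewrite (_ : horner (p * 'X + r%:P) = (horner p * id) + cst r); last first.
  by apply/funext => y; rewrite !hornerE.
apply: is_derive_eq.
by rewrite derivMXaddC !hornerE /= [_%:A]mulr1 [x *: _]mulrC.
Qed.

Section Monomials.
Variables (C : numClosedFieldType) (J T : finType).
Implicit Types (c : T -> C) (m : T -> J -> nat) (e : J -> C).

Definition monomial_sum c m e : C := \sum_i c i * \prod_j e j ^+ m i j.

(** The truncated subtraction of exponents is harmless: where the exponent is already 0, the new
    coefficient is 0. *)
Lemma pderiv_monomial_sum k c m : pderiv k (monomial_sum c m) =
  monomial_sum (fun i => c i * (m i k)%:R) (fun i j => m i j - (j == k))%N.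
Proof.
apply/funext => e; rewrite /pderiv.
pose r i := c i * \prod_(j | j != k) e j ^+ m i j.
pose P := \sum_i r i *: 'X^(m i k).
rewrite (_ : (fun t : C => _) = horner P); last first.
  apply/funext => t; rewrite /P horner_sum; apply: eq_bigr => i _.
  rewrite hornerZ hornerXn (bigD1 k) //= eqxx mulrCA mulrC; congr (_ * _ * _).
  by apply: eq_bigr => j /negbTE ->.
have D := is_derive_horner P (e k).
rewrite derive1E (derive_val (is_derive := D)).
rewrite /P linear_sum horner_sum; apply: eq_bigr => i _.
rewrite linearZ /= derivXn hornerZ hornerMn hornerXn [in RHS](bigD1 k) //= eqxx subn1.
rewrite -mulr_natl /r [in RHS](eq_bigr (fun j => e j ^+ m i j)).
  by ring.
by move=> j /negbTE ->; rewrite subn0.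
Qed.

Lemma foldr_pderiv_monomial_sum c m (s : seq J) : uniq s ->
  foldr (@pderiv C J) (monomial_sum c m) s =
  monomial_sum (fun i => c i * \prod_(k <- s) (m i k)%:R) (fun i j => m i j - (j \in s))%N.
Proof.
elim: s => [_|k s IH /andP[ks us]] /=.
  apply/funext => e; apply: eq_bigr => i _; rewrite big_nil mulr1.
  by congr (_ * _); apply: eq_bigr => j _; rewrite subn0.
rewrite (IH us) pderiv_monomial_sum; apply/funext => e; apply: eq_bigr => i _.
congr (_ * _).
  by rewrite big_cons (negbTE ks) subn0 -mulrA [X in c i * X]mulrC.
apply: eq_bigr => j _; rewrite in_cons -subnDA; congr (_ ^+ (_ - _)).
by have [->|_] := eqVneq j k; rewrite ?(negbTE ks) ?addn0.
Qed.

Lemma mixed_pderiv_monomial_sum c m : mixed_pderiv (monomial_sum c m) (fun=> 0) =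
  \sum_(i | [forall k, m i k == 1%N]) c i.
Proof.
rewrite /mixed_pderiv foldr_pderiv_monomial_sum ?enum_uniq // [RHS]big_mkcond.
apply: eq_bigr => i _; rewrite big_enum -mulrA -big_split /=.
(* A variable of exponent [m] contributes [m] times the power of 0 with exponent [m - 1]: the first
   kills [m = 0], the second kills [m > 1]. *)
rewrite (eq_bigr (fun k => (m i k == 1%N)%:R)) => [|k _].
  case: forallP => [H|H].
    by rewrite big1 ?mulr1 // => k _; rewrite H.
  have /existsP[k] : [exists k, m i k != 1%N].
    by rewrite -negb_forall; apply/forallP.
  by move=> /negbTE mk; rewrite (bigD1 k) //= mk mul0r mulr0.
rewrite mem_enum subn1; case: (m i k) => [|[|n]]; rewrite ?mul0r ?mul1r //=.
by rewrite expr0n mulr0.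
Qed.
End Monomials.
End MixedDerivative.

Lemma big_option (R : Type) (idx : R) (op : Monoid.com_law idx) (J : finType)
    (f : option J -> R) :
  \big[op/idx]_o f o = op (f None) (\big[op/idx]_k f (Some k)).
Proof.
rewrite (bigD1 None) //=; congr (op _ _).
rewrite (reindex_omap Some id) /=; first by apply: eq_bigl => k; rewrite eqxx.
by case.
Qed.

(* Each factor l of a product picks either its constant term (None) or its
   part linear in the variable k (Some k). *)
Definition once (I J : finType) (f : {ffun I -> option J}) : bool :=
  [forall k, #|[pred l | f l == Some k]| == 1%N].

(** Expanding the product yields one monomial per [t] and labelling, with [e k] raised to the number
    of factors labelled [k]; the mixed derivative at 0 keeps those whose exponents are all 1. *)
Lemma mixed_pderiv_prod (C : numClosedFieldType) (J T I : finType) (w : T -> C)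
    (X : T -> I -> C) (Y : J -> T -> I -> C) :
  mixed_pderiv (fun e : J -> C =>
    \sum_t w t * \prod_l (X t l + \sum_k e k * Y k t l)) (fun=> 0) =
  \sum_(f : {ffun I -> option J} | once f) \sum_t
    w t * \prod_l (if f l is Some k then Y k t l else X t l).
Proof.
pose c (i : {ffun I -> option J} * T) : C :=
  w i.2 * \prod_l (if i.1 l is Some k then Y k i.2 l else X i.2 l).
pose m (i : {ffun I -> option J} * T) k := #|[pred l | i.1 l == Some k]|.
rewrite (_ : (fun e => _) = monomial_sum c m); last first.
  apply/funext => e.
  pose g o := if o is Some k then e k else 1.
  transitivity (\sum_t \sum_(f : {ffun I -> option J})
      c (f, t) * \prod_k e k ^+ m (f, t) k); last first.
    by rewrite exchange_big pair_bigA; apply: eq_bigr => -[].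
  apply: eq_bigr => t _.
  transitivity (w t * \prod_l \sum_o
      g o * (if o is Some k then Y k t l else X t l)).
    congr (_ * _); apply: eq_bigr => l _; rewrite big_option /= mul1r.
    by congr (_ + _).
  rewrite bigA_distr_bigA mulr_sumr; apply: eq_bigr => f _.
  rewrite big_split /= mulrCA mulrC; congr (_ * _).
  rewrite (partition_big (fun l => f l) xpredT) //= big_option /=.
  rewrite big1 => [|l /eqP->] //; rewrite mul1r; apply: eq_bigr => k _.
  rewrite (eq_bigr (fun=> e k)) => [|l /eqP->] //.
  by rewrite prodr_const.
rewrite mixed_pderiv_monomial_sum [RHS]pair_big_dep /=.
by apply: eq_bigl => -[f t]; rewrite andbT.
Qed.

Lemma perm_trace_relabel (R : comPzRingType) (I : finType) (N : nat)
    (s g : {perm I}) (M : I -> 'M[R]_N) :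
  perm_trace s (fun l => M (g l)) = perm_trace (s ^ g)%g M.
Proof.
rewrite /perm_trace (reindex_inj (can_inj (@wactK _ _ g))) /=.
apply: eq_bigr => a _; rewrite [RHS](reindex_inj (@perm_inj _ g)) /=.
by apply: eq_bigr => l _; rewrite !ffunE conjgE !permM permK.
Qed.

Lemma specht_char_conj (F : fieldType) (lam : seq nat) (I : finType)
    (s g : {perm I}) : specht_char F lam (s ^ g)%g = specht_char F lam s.
Proof.
rewrite /specht_char conjgE repr_mxM ?inE // mxtrace_mulC -repr_mxM ?inE //.
by rewrite mulgK.
Qed.

(** Built one element of [J] at a time: a transposition corrects the new value and, by injectivity,
    leaves the earlier ones alone. *)
Lemma perm_extends (I J : finType) (i f : J -> I) : injective i -> injective f ->
  exists g : {perm I}, forall k, g (i k) = f k.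
Proof.
move=> injI injF.
have [g gP] : exists g : {perm I}, {in enum J, forall k, g (i k) = f k}.
  elim: (enum J) (enum_uniq J) => [_|k s IH /andP[ks /IH[g gP]]]; first by exists 1%g.
  exists (g * tperm (g (i k)) (f k))%g => k'; rewrite in_cons permM.
  case/orP=> [/eqP->|k's]; first by rewrite tpermL.
  have ne : k != k' by apply: contraNneq ks => ->.
  have ne1 : g (i k) != g (i k') by rewrite (inj_eq (@perm_inj _ g)) (inj_eq injI).
  have ne2 : f k != g (i k') by rewrite gP // (inj_eq injF).
  by rewrite tpermD // gP.
by exists g => k; apply: gP; rewrite mem_enum.
Qed.

Section Labellings.
Variables (I J : finType).
Implicit Types (i : {ffun J -> I}) (f : {ffun I -> option J}).

(* The labelling of the factors that differentiates the factor i k along k. *)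
Definition label i : {ffun I -> option J} := [ffun l => [pick k | i k == l]].

Lemma labelP i l k : injective i -> (label i l == Some k) = (i k == l).
Proof.
move=> inj; rewrite ffunE; case: pickP => [k' /eqP<-|none].
  by rewrite (inj_eq inj) [RHS]eq_sym.
by rewrite none.
Qed.

Lemma label_once i : injective i -> once (label i).
Proof.
move=> inj; apply/forallP => k; rewrite -(card1 (i k)).
by apply/eqP/eq_card => l; rewrite !inE labelP // eq_sym.
Qed.

Lemma onceP f : once f -> exists2 i : {ffun J -> I}, injective i & f = label i.
Proof.
move=> /forallP one.
have ex k : {l | f l = Some k & forall l', f l' = Some k -> l' = l}.
  have : exists l, (f l == Some k) && [forall l', (f l' == Some k) ==> (l' == l)].
    have /card1P[l H] : #|[pred l | f l == Some k]| == 1%N by [].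
    exists l; have := H l; rewrite !inE eqxx => ->.
    by apply/forallP => l'; have := H l'; rewrite !inE => ->; apply/implyP.
  move=> E; have := xchooseP E; set l := xchoose _ => /andP[/eqP ? /forallP u].
  by exists l => // l' /eqP fl'; apply/eqP; apply: implyP (u l') fl'.
pose i := [ffun k => s2val (ex k)].
have iP k : f (i k) = Some k by rewrite ffunE; case: (ex k).
have iU k l : f l = Some k -> l = i k by rewrite ffunE; case: (ex k) => ? ? /= H /H.
have inj : injective i by move=> k k' E; have := iP k; rewrite E iP => -[].
exists i => //; apply/ffunP => l; rewrite ffunE.
case: pickP => [k /eqP <- //|none].
by case E: (f l) => [k|//]; have := none k; rewrite -(iU _ _ E) eqxx.
Qed.

Lemma label_inj i i' : injective i -> injective i' -> label i = label i' -> i = i'.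
Proof.
move=> inj inj' E; apply/ffunP => k; apply/esym/eqP.
by rewrite -labelP // -E labelP.
Qed.

Lemma card_once : #|[set f : {ffun I -> option J} | once f]| = (#|I| ^_ #|J|)%N.
Proof.
rewrite -(card_inj_ffuns J I).
rewrite -(@card_in_imset _ _ label [set i : {ffun J -> I} | injectiveb i]).
  apply: eq_card => f; rewrite inE; apply/idP/imsetP => [/onceP[i inj ->]|[j]].
    by exists i => //; rewrite inE; apply/injectiveP.
  by rewrite inE => /injectiveP inj ->; apply: label_once.
by move=> i i'; rewrite !inE => /injectiveP inj /injectiveP inj'; apply: label_inj.
Qed.

(** All labellings using each [k] once lie in one orbit under permutations of the factors. *)
Lemma label_relabel i f : injective i -> once f ->
  exists g : {perm I}, forall l, label i l = f (g l).
Proof.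
move=> inj /onceP[i' inj' ->]; have [g gP] := perm_extends inj inj'.
exists g => l; case E: (label i l) => [k|].
  move/eqP: E; rewrite labelP // => /eqP <-.
  by rewrite gP; apply/esym/eqP; rewrite labelP.
case E': (label i' (g l)) => [k|//]; move/eqP: E'; rewrite labelP // -gP => /eqP.
by move/perm_inj/eqP; rewrite -labelP // E.
Qed.

End Labellings.

Section Polarization.
Variables (C : numClosedFieldType) (lam : seq nat) (I J : finType) (N : nat).
Variables (h : 'M[C]_N) (E : J -> 'M[C]_N).
Hypotheses (lamP : is_partition lam) (cardI : #|I| = sumn lam).

Definition mixed_trace (f : {ffun I -> option J}) : C :=
  \sum_(s : {perm I}) specht_char C lam s *
    perm_trace s^-1%g (fun l => if f l is Some k then E k else h).

(** Divided by the factorial, the Frobenius formula presents the Schur function along the directions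
    [E k] as a sum, over pairs of a permutation and a word, of products of affine forms in [e]. *)
Lemma mixed_pderiv_schur :
  (sumn lam)`!%:R *
  mixed_pderiv (fun e : J -> C => schur_mx lam (h + \sum_k e k *: E k))
    (fun=> 0) =
  \sum_(f : {ffun I -> option J} | once f) mixed_trace f.
Proof.
pose kf : C := (sumn lam)`!%:R.
have kf0 : kf != 0 by rewrite pnatr_eq0 -lt0n fact_gt0.
rewrite (_ : (fun e => _) = (fun e : J -> C => \sum_(t : {perm I} * {ffun I -> 'I_N})
   (kf^-1 * specht_char C lam t.1) *
   \prod_l (h (t.2 l) (t.2 (t.1^-1%g l)) +
      \sum_k e k * E k (t.2 l) (t.2 (t.1^-1%g l))))).
  rewrite mixed_pderiv_prod mulr_sumr; apply: eq_bigr => f _.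
  rewrite /mixed_trace -(pair_bigA _ (fun (s : {perm I}) (a : {ffun I -> 'I_N}) =>
     kf^-1 * specht_char C lam s *
     \prod_l if f l is Some k then E k (a l) (a (s^-1%g l)) else h (a l) (a (s^-1%g l)))) /=.
  rewrite mulr_sumr; apply: eq_bigr => s _; rewrite -mulr_sumr !mulrA mulfV // mul1r.
  congr (_ * _); apply: eq_bigr => a _; apply: eq_bigr => l _.
  by case: (f l).
apply/funext => e; apply: (mulfI kf0).
rewrite -(frobenius_schur _ lamP cardI).
rewrite -(pair_bigA _ (fun (s : {perm I}) (a : {ffun I -> 'I_N}) =>
     kf^-1 * specht_char C lam s *
   \prod_l (h (a l) (a (s^-1%g l)) + \sum_k e k * E k (a l) (a (s^-1%g l))))) /=.
rewrite mulr_sumr; apply: eq_bigr => s _; rewrite -mulr_sumr !mulrA mulfV // mul1r.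
congr (_ * _); apply: eq_bigr => a _; apply: eq_bigr => l _.
by rewrite !mxE summxE; congr (_ + _); apply: eq_bigr => k _; rewrite mxE.
Qed.

(** All labellings in [mixed_pderiv_schur] give the same trace, and they are as many as the
    injections from [J] to [I]; cancelling this falling factorial against the factorial of
    [sumn lam] leaves the smaller factorial. *)
Lemma mixed_pderiv_schur_label (i : {ffun J -> I}) : injective i ->
  (sumn lam - #|J|)`!%:R *
    mixed_pderiv (fun e : J -> C => schur_mx lam (h + \sum_k e k *: E k))
    (fun=> 0) =
  mixed_trace (label i).
Proof.
move=> inj.
have leJ : (#|J| <= sumn lam)%N by rewrite -cardI; apply: leq_card inj.
have := mixed_pderiv_schur; rewrite (eq_bigr (fun=> mixed_trace (label i))).
  rewrite sumr_const -[#|_|](cardsE) card_once cardI -(ffact_fact leJ).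
  rewrite natrM -[in RHS]mulr_natl -!mulrA => /mulfI; apply.
  by rewrite pnatr_eq0 -lt0n ffact_gt0.
(* Relabelling the factors conjugates [s], which the character does not see. *)
move=> f oncef; have [g gP] := label_relabel inj oncef.
rewrite /mixed_trace [LHS](reindex_inj (conjg_inj g)) /=.
apply: eq_bigr => s _; rewrite specht_char_conj -conjVg -perm_trace_relabel.
congr (_ * _); apply: eq_bigr => a _; apply: eq_bigr => l _.
by rewrite gP.
Qed.

Lemma mixed_pderiv_schur_eq0 : (sumn lam < #|J|)%N ->
  mixed_pderiv (fun e : J -> C => schur_mx lam (h + \sum_k e k *: E k))
    (fun=> 0) = 0.
Proof.
move=> lt; have := mixed_pderiv_schur; rewrite big_pred0 => [/eqP|f].
  by rewrite mulf_eq0 pnatr_eq0 eqn0Ngt fact_gt0 => /eqP.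
apply/negbTE/negP => /onceP[i inj _].
by have := leq_card i inj; rewrite cardI leqNgt lt.
Qed.

End Polarization.

(** * Partial traces *)

Section Operators.
Variables (R : comPzRingType) (N : nat).

Lemma coefop_mk (I : finType) F (a b : {ffun I -> 'I_N}) :
  coefop (mkop F : tend R N I) a b = F a b.
Proof. by rewrite /coefop mxE !enum_rankK. Qed.

Lemma coefopP (I : finType) (X Y : tend R N I) :
  (forall a b, coefop X a b = coefop Y a b) -> X = Y.
Proof.
move=> E; apply/matrixP => i j.
by have := E (enum_val i) (enum_val j); rewrite /coefop !enum_valK.
Qed.

Lemma coefop_mul (I : finType) (X Y : tend R N I) a b :
  coefop (X *m Y) a b = \sum_c coefop X a c * coefop Y c b.
Proof.
rewrite /coefop mxE (reindex enum_rank) //=.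
by exists enum_val => i _; [rewrite enum_rankK|rewrite enum_valK].
Qed.

Lemma tensor_opM (I : finType) (X Y : I -> 'M[R]_N) :
  tensor_op X *m tensor_op Y = tensor_op (fun l => X l *m Y l).
Proof.
apply: coefopP => a b; rewrite coefop_mul coefop_mk.
under [RHS]eq_bigr => l _ do rewrite mxE.
rewrite bigA_distr_bigA /=; apply: eq_bigr => c _.
by rewrite !coefop_mk big_split.
Qed.

Lemma tensor_op1 (I : finType) : tensor_op (fun _ : I => 1%:M : 'M[R]_N) = 1%:M.
Proof.
apply: coefopP => a b; rewrite coefop_mk /coefop mxE (inj_eq enum_rank_inj).
case: eqP => [->|/eqP ne]; first by rewrite big1 // => l _; rewrite mxE eqxx.
have /existsP[l ll] : [exists l, a l != b l].
  rewrite -negb_forall; apply: contra ne => /forallP E.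
  by apply/eqP/ffunP => l; apply/eqP.
by rewrite (bigD1 l) //= mxE (negbTE ll) mul0r.
Qed.

(** The positions [v k] are distinct, so no two factors meet. An arbitrary index type serves both
    products over the elements of [K] and products over natural numbers. *)
Lemma prod_at_factor (T : eqType) (L : {fset nat}) (v : T -> nat) (s : seq T)
    (X : T -> 'M[R]_N) (Y : L -> 'M[R]_N) : uniq (map v s) ->
  (forall l k, k \in s -> v k = val l -> Y l = X k) ->
  (forall l, val l \notin map v s -> Y l = 1%:M) ->
  \prod_(k <- s) at_factor L (v k) (X k) = tensor_op Y.
Proof.
elim: s Y => [|k s IH] Y /=.
  move=> _ _ Y1; rewrite big_nil -[1]tensor_op1.
  by apply: coefopP => a b; rewrite !coefop_mk; apply: eq_bigr => l _; rewrite Y1.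
move=> /andP[ks us] YX Y1.
rewrite big_cons (IH (fun l => if val l == v k then 1%:M else Y l) us).
- rewrite -[_ * _]/(_ *m _) /at_factor tensor_opM.
  apply: coefopP => a b; rewrite !coefop_mk; apply: eq_bigr => l _.
  case: eqP => [E|_]; rewrite ?mulmx1 ?mul1mx //.
  by rewrite (YX l k) ?mem_head.
- move=> l k' k's E; case: eqP => [E'|_]; last by apply: YX; rewrite // in_cons k's orbT.
  by case/negP: ks; apply/mapP; exists k' => //; rewrite E.
- by move=> l ls; case: eqP => // /eqP E; apply: Y1; rewrite in_cons negb_or E.
Qed.

End Operators.

Section SubFactors.
Variables (K L : {fset nat}) (KL : (K `<=` L)%fset) (N : nat).

Definition fincl_ffun : {ffun K -> L} := [ffun k => fincl KL k].

Lemma fincl_ffun_inj : injective fincl_ffun.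
Proof. by move=> k k'; rewrite !ffunE => /(congr1 val)/= /val_inj. Qed.

Variant label_spec (l : L) : option K -> Prop :=
| LabelSome k of val k = val l : label_spec l (Some k)
| LabelNone of val l \notin K : label_spec l None.

Lemma labelK l : label_spec l (label fincl_ffun l).
Proof.
rewrite ffunE; case: pickP => [k /eqP<-|none].
  by constructor; rewrite ffunE.
constructor; apply/negP => lK.
by have /eqP[] := none [` lK]%fset; apply: val_inj; rewrite ffunE.
Qed.

Lemma restrictsE (a : {ffun K -> 'I_N}) (b : {ffun L -> 'I_N}) :
  restricts a b = (a == [ffun k => b (fincl KL k)]).
Proof.
apply/forallP/eqP => [ab|-> k].
  by apply/ffunP => k; rewrite ffunE; apply/eqP; apply: (implyP (forallP (ab k) _)).
apply/forallP => l; apply/implyP => /eqP kl; rewrite ffunE.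
by apply/eqP; congr (b _); apply: val_inj.
Qed.

Lemma coefop_extend (R : pzRingType) (X : tend R N K) (b b' : {ffun L -> 'I_N}) :
  coefop (extend_op L X) b b' = (agree_off K b b')%:R *
    coefop X [ffun k => b (fincl KL k)] [ffun k => b' (fincl KL k)].
Proof.
rewrite /coefop /extend_op mxE !enum_rankK.
by rewrite (big_pred1 _ (restrictsE ^~ _)) (big_pred1 _ (restrictsE ^~ _)).
Qed.

End SubFactors.

Section Hamiltonians.
Variables (C : numClosedFieldType) (N : nat) (K L : {fset nat}).
Hypothesis KL : (K `<=` L)%fset.
Local Notation inc := (fincl_ffun KL).

Lemma label_inc k : label inc (fincl KL k) = Some k.
Proof. by apply/eqP; rewrite labelP ?ffunE //; apply: fincl_ffun_inj. Qed.

(** A pair of multi-indices determines the only family [p] with a nonzero entry there, which reduces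
    the sum in [dop] to a single mixed derivative. *)
Lemma coefop_matrix_units (p : {ffun K -> 'I_N * 'I_N}) (b b' : {ffun L -> 'I_N}) :
  coefop (\prod_k at_factor L (val k) (delta_mx (p k).1 (p k).2)) b b' =
  (agree_off K b b' &&
    (p == [ffun k => (b (fincl KL k), b' (fincl KL k))]))%:R :> C.
Proof.
pose Y l : 'M[C]_N :=
  if label inc l is Some k then delta_mx (p k).1 (p k).2 else 1%:M.
have YP : {in index_enum K, forall k, Y (fincl KL k) = delta_mx (p k).1 (p k).2}.
  by move=> k _; rewrite /Y label_inc.
rewrite (@prod_at_factor _ _ _ _ _ _ _ Y); first last.
- by move=> l; rewrite /Y; case: labelK => // k kl /mapP[]; exists k; rewrite ?mem_index_enum.
- move=> l k ks kl; rewrite -(YP k ks); congr Y.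
  exact: val_inj.
- by rewrite map_inj_uniq ?index_enum_uniq //; apply: val_inj.
rewrite coefop_mk; case: andP => [[/forallP ag /eqP pE]|no].
  rewrite big1 // => l _; rewrite /Y; case: labelK => [k kl|lK].
    rewrite pE ffunE mxE (_ : fincl KL k = l) ?eqxx //; exact: val_inj.
  by rewrite mxE (implyP (ag l)).
have [ag|] := boolP (agree_off K b b'); last first.
  case/forallPn => l; rewrite negb_imply => /andP[lK ne].
  rewrite (bigD1 l) //= /Y; case: labelK => [k kl|_].
    by rewrite -kl (valP k) in lK.
  by rewrite mxE (negbTE ne) mul0r.
have /existsP[k kk] : [exists k, p k != (b (fincl KL k), b' (fincl KL k))].
  rewrite -negb_forall; apply/negP => /forallP E; apply: no; split=> //.
  by apply/eqP/ffunP => k; rewrite ffunE; apply/eqP.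
rewrite (bigD1 (fincl KL k)) //= YP ?mem_index_enum // mxE.
case: eqP => [e1|_]; last by rewrite mul0r.
case: eqP => [e2|_]; last by rewrite mul0r.
by rewrite [p k]surjective_pairing -e1 -e2 eqxx in kk.
Qed.

Lemma coefop_dop (f : 'M[C]_N -> C) h (b b' : {ffun L -> 'I_N}) :
  coefop (dop L K f h) b b' = (agree_off K b b')%:R *
    mixed_pderiv (fun e : K -> C => f (h + \sum_k e k *:
      delta_mx (b' (fincl KL k)) (b (fincl KL k)))) (fun=> 0).
Proof.
rewrite /coefop /dop summxE.
pose p0 := [ffun k => (b (fincl KL k), b' (fincl KL k))].
under eq_bigr => p _ do rewrite mxE [X in _ * X](coefop_matrix_units p b b') -/p0.
rewrite (bigD1 p0) //= [X in _ + X]big1 ?addr0 => [|p /negbTE ->]; last first.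
  by rewrite andbF mulr0.
rewrite eqxx andbT mulrC; congr (_ * mixed_pderiv _ _); apply/funext => e.
by congr (f (h + _)); apply: eq_bigr => k _; rewrite /p0 ffunE.
Qed.

Lemma coefop_diag_alpha (lam : seq nat) (h : 'M[C]_N) (c c' : {ffun L -> 'I_N}) :
  coefop (diag_action L (L `\` K)%fset h *m alpha_op C N lam L) c c' =
  \sum_(s : {perm L}) specht_char C lam s *
    \prod_l (if label inc l is Some _ then 1%:M else h) (c l) (c' (s^-1%g l)).
Proof.
rewrite /diag_action (@prod_at_factor _ _ _ _ id _ _
  (fun l => if label inc l is Some _ then 1%:M else h)); first last.
- move=> l; rewrite map_id inE; case: labelK => // lK.
  by rewrite lK /= (valP l).
- move=> l k; rewrite inE => /andP[kK _] E; case: labelK => // k' E'.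
  by rewrite E -E' (valP k') in kK.
- by rewrite map_id fset_uniq.
rewrite coefop_mul.
under eq_bigr => d _ do rewrite {2}/coefop summxE mulr_sumr.
rewrite exchange_big; apply: eq_bigr => s _.
(* In column [c'] the operator of [s] has its only nonzero entry in the row [wact c' s^-1]. *)
rewrite (bigD1 (wact c' s^-1%g)) //= [X in _ + X]big1 ?addr0 => [|d ds].
  rewrite mxE -[perm_op _ _ _ _ _]/(coefop (perm_op C N s) _ _) !coefop_mk.
  rewrite (_ : [forall l, _]) ?mulr1 1?mulrC.
    by congr (_ * _); apply: eq_bigr => l _; rewrite [wact _ _ _]ffunE.
  by apply/forallP => l; rewrite ffunE permK.
rewrite mxE -[perm_op _ _ _ _ _]/(coefop (perm_op C N s) _ _) !coefop_mk.
case: forallP => [E|]; last by rewrite !mulr0.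
case/eqP: ds; apply/ffunP => l; rewrite ffunE -(eqP (E _)) permKV //.
Qed.

(** At a factor in [K], the identity matrix and the condition that [c'] restricts to [a'] together
    make up the entry of a matrix unit; so an entry of the partial trace is a full trace with matrix
    units inserted at [K]. *)
Lemma coefop_ptrace (lam : seq nat) (h : 'M[C]_N) (a a' : {ffun K -> 'I_N}) :
  coefop (ptrace K (diag_action L (L `\` K)%fset h *m alpha_op C N lam L)) a a' =
  mixed_trace lam h (fun k => delta_mx (a' k) (a k)) (label inc).
Proof.
rewrite coefop_mk (exchange_big_dep (restricts a')) /=; last by move=> ? ? _ /andP[].
(* For given [c'] the row index is forced: it is [a] on [K] and [c'] elsewhere. *)
pose glue (c' : {ffun L -> 'I_N}) : {ffun L -> 'I_N} :=
  [ffun l => if label inc l is Some k then a k else c' l].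
have glueE c' l : glue c' l = if label inc l is Some k then a k else c' l.
  by rewrite ffunE.
transitivity (\sum_(c' : {ffun L -> 'I_N} | restricts a' c')
   coefop (diag_action L (L `\` K)%fset h *m alpha_op C N lam L) (glue c') c').
  apply: eq_bigr => c' rc'; apply: big_pred1 => c; rewrite rc' /= (restrictsE KL).
  apply/andP/eqP => [[/eqP ac /forallP ag]|->].
    apply/ffunP => l; rewrite glueE; case: labelK => [k kl|lK].
      by rewrite ac ffunE; congr (c _); apply: val_inj.
    by apply/eqP/(implyP (ag l)).
  split; first by apply/eqP/ffunP => k; rewrite ffunE glueE label_inc.
  apply/forallP => l; apply/implyP => lK; rewrite glueE; case: labelK => // k kl.
  by rewrite -kl (valP k) in lK.
under eq_bigr => c' _ do rewrite coefop_diag_alpha.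
rewrite exchange_big; apply: eq_bigr => s _; rewrite -mulr_sumr; congr (_ * _).
rewrite big_mkcond; apply: eq_bigr => c' _; rewrite (restrictsE KL).
case: eqP => [E|/eqP ne].
  apply: eq_bigr => l _; rewrite glueE; case: labelK => [k kl|_] //.
  rewrite !mxE E ffunE (_ : fincl KL k = l); last exact: val_inj.
  by rewrite eqxx eq_sym.
have /existsP[k kk] : [exists k, a' k != c' (fincl KL k)].
  rewrite -negb_forall; apply: contra ne => /forallP E.
  by apply/eqP/ffunP => k; rewrite ffunE; apply/eqP.
by rewrite (bigD1 (fincl KL k)) //= label_inc mxE eq_sym (negbTE kk) mul0r.
Qed.

End Hamiltonians.

(** * Counting the sets [L] and assembling the formula *)

(** Removing [K] turns these sets into the subsets of the complement of [K] in [S] with [k - |K|]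
    elements. *)
Lemma count_fpowerset_between (S K : {fset nat}) (k : nat) :
  (K `<=` S)%fset -> (#|` K| <= k)%N ->
  count (fun L => (K `<=` L)%fset && (#|` L| == k)) (fpowerset S) =
  'C(#|` S| - #|` K|, k - #|` K|).
Proof.
move=> KS Kk.
pose g L := fsub S (L `\` K)%fset.
pose D := [set X : {set S} | X \subset ~: fsub S K & #|X| == (k - #|` K|)%N].
have -> : 'C(#|` S| - #|` K|, k - #|` K|) = #|D|.
  by rewrite cards_draws cardsCs finset.setCK card_fsub // -cardfE.
rewrite -size_filter -(size_map g) cardE; apply/perm_size/uniq_perm.
- rewrite map_inj_in_uniq ?filter_uniq ?fset_uniq // => L L'.
  rewrite !mem_filter !fpowersetE => /andP[/andP[KL _] LS] /andP[/andP[KL' _] LS'].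
  move/fsub_inj; rewrite !inE => E.
  have DL : (L `\` K = L' `\` K)%fset.
    by apply: E; apply: fsubset_trans (fsubsetDl _ _) _.
  have join (A : {fset nat}) : (K `<=` A)%fset -> (K `|` (A `\` K) = A)%fset.
    move=> /fsubsetP KA; apply/fsetP => x; rewrite !inE.
    by case: (boolP (x \in K)) => //= /KA ->.
  by rewrite -(join _ KL) DL join.
- exact: enum_uniq.
move=> X; rewrite mem_enum inE; apply/mapP/andP => [[L]|[/fintype.subsetP XK /eqP Xk]].
  rewrite mem_filter fpowersetE => /andP[/andP[KL /eqP Lk] LS] ->.
  split; first by apply/fintype.subsetP => x; rewrite !inE => /andP[].
  by rewrite card_fsub ?(fsubset_trans (fsubsetDl _ _)) // cardfsDS // Lk.
pose V := [fsetval x in X]%fset.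
have VS : (V `<=` S)%fset by apply/fsubsetP => _ /imfsetP[x _ ->]; apply: valP.
have VX (x : S) : (val x \in V) = (x \in X) by rewrite -[in RHS](FSetK X) in_fsub.
have gV : g (K `|` V)%fset = X.
  apply/finset.setP => x; rewrite in_fsub in_fsetD in_fsetU VX.
  case: (boolP (x \in X)) => xX; last first.
    by rewrite orbF andNb.
  by have := XK x xX; rewrite !inE orbT andbT.
exists (K `|` V)%fset => //.
rewrite mem_filter fpowersetE fsubUset KS VS fsubsetUl !andbT /=.
have : #|` ((K `|` V) `\` K)%fset| = (k - #|` K|)%N.
  rewrite -Xk -[in RHS]gV card_fsub // (fsubset_trans (fsubsetDl _ _)) //.
  by rewrite fsubUset KS VS.
rewrite cardfsDS ?fsubsetUl // => E; apply/eqP.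
by rewrite -(subnK (fsubset_leq_card (fsubsetUl K V))) E subnK.
Qed.

Lemma gaudin_ptrace (C : numClosedFieldType) (N n m : nat) (h : 'M[C]_N)
    (z : nat -> C) (lam : seq nat) (hlam : is_partition lam)
    (hm : (maxn n (sumn lam) <= m)%N) :
  gaudin n lam h z =
  \sum_(K <- fpowerset (seg n))
    \sum_(L <- fpowerset (seg m) | (K `<=` L)%fset && (#|` L| == sumn lam))
      (((m - sumn lam)`!%:R / (m - #|` K|)`!%:R)%:P * shift_prod n z K) *:
        map_mx polyC
          (extend_op (seg n)
             (ptrace K (diag_action L (L `\` K)%fset h *m
                        alpha_op C N lam L))).
Proof.
rewrite /gaudin; apply: eq_big_seq => K; rewrite fpowersetE => Kn.
have card_seg k : #|` seg k| = k.
  by rewrite card_fseq undup_id ?iota_uniq // size_iota.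
have [le_nm le_km] : (n <= m)%N /\ (sumn lam <= m)%N.
  by move: hm; rewrite geq_max => /andP.
have Km : (K `<=` seg m)%fset.
  apply: fsubset_trans Kn _; apply/fsubsetP => j; rewrite !inE !mem_iota.
  by case/andP=> -> /= lt; apply: leq_trans lt _; rewrite !add1n ltnS.
(* If [K] has more than [|lam|] elements, the derivative vanishes and no [L] of size [|lam|]
   contains [K]. *)
have [le_Kk|lt_kK] := leqP #|` K| (sumn lam); last first.
  rewrite [RHS]big1 ?[X in _ *: X](_ : _ = 0) ?scaler0 //.
    rewrite -[RHS](map_mx0 polyC); congr map_mx; apply: coefopP => b b'.
    rewrite (coefop_dop Kn) (mixed_pderiv_schur_eq0 _ _ hlam (card_ord _)) ?mulr0.
      by rewrite /coefop mxE.
    by rewrite -cardfE.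
  move=> L /andP[KL /eqP cL].
  by have := fsubset_leq_card KL; rewrite cL leqNgt lt_kK.
(* Each partial trace is the same multiple of the derivative, whatever [L] is. *)
have extE L : (K `<=` L)%fset -> #|` L| = sumn lam ->
    extend_op (seg n) (ptrace K (diag_action L (L `\` K)%fset h *m
      alpha_op C N lam L)) =
    (sumn lam - #|` K|)`!%:R *: dop (seg n) K (schur_mx lam (N := N)) h.
  move=> KL cL; apply: coefopP => b b'.
  rewrite (coefop_extend Kn) (coefop_ptrace KL).
  rewrite (_ : (fun k => delta_mx _ _) =
      (fun k => delta_mx (b' (fincl Kn k)) (b (fincl Kn k)))); last first.
    by apply/funext => k; rewrite !ffunE.
  have cardL : #|{: L}| = sumn lam by rewrite -cL cardfE.
  rewrite -(mixed_pderiv_schur_label _ _ hlam cardL (@fincl_ffun_inj _ _ KL)).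
  rewrite /coefop mxE -/(coefop _ b b') (coefop_dop Kn) -cardfE mulrCA.
  by [].
rewrite (eq_bigr (fun=> ((m - sumn lam)`!%:R / (m - #|` K|)`!%:R *
    (sumn lam - #|` K|)`!%:R)%:P *: (shift_prod n z K *:
    map_mx polyC (dop (seg n) K (schur_mx lam (N := N)) h)))); last first.
  move=> L /andP[KL /eqP cL]; rewrite extE // map_mxZ !scalerA; congr (_ *: _).
  by rewrite [in RHS]polyCM mulrAC.
(* The number of sets [L] times [(|lam| - |K|)!] times [(m - |lam|)!] is [(m - |K|)!], so the total
   coefficient is 1. *)
rewrite big_const_seq iter_addr_0 count_fpowerset_between // card_seg.
rewrite -scaler_nat scalerA -polyC_natr -polyCM [X in X%:P](_ : _ = 1) ?scale1r //.
have -> : (m - sumn lam = (m - #|` K|) - (sumn lam - #|` K|))%N by lia.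
rewrite mulrCA mulrAC -!natrM mulrC.
have H : (sumn lam - #|` K| <= m - #|` K|)%N by rewrite leq_sub2r.
by rewrite mulnC -mulnA (bin_fact H) mulVf // pnatr_eq0 -lt0n fact_gt0.
Qed.

Theorem theorem5p2 (R : realType) (N n m : nat) (h : 'M[R[i]]_N)
    (z : nat -> R[i]) (lam : seq nat) (hlam : is_partition lam)
    (hm : (maxn n (sumn lam) <= m)%N) :
  gaudin n lam h z =
  \sum_(K <- fpowerset (seg n))
    \sum_(L <- fpowerset (seg m) | (K `<=` L)%fset && (#|` L| == sumn lam))
      (((m - sumn lam)`!%:R / (m - #|` K|)`!%:R)%:P * shift_prod n z K) *:
        map_mx polyC
          (extend_op (seg n)
             (ptrace K (diag_action L (L `\` K)%fset h *m
                        alpha_op R[i] N lam L))).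
Proof. exact: gaudin_ptrace. Qed.
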